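(* Let $r \ge 2$ and $s_r \ge \cdots \ge s_1 \ge 1$ be integers, let $s := s_1+\cdots+s_r$, and let $\mathbb{B}$ be an $r$-partite $r$-graph with part sizes $s_1,\ldots,s_r$. Then there is $n_0$ such that for every $n\ge n_0$, $$\mathrm{ex}(n,(t+1)\mathbb{B}) \le \binom{s(t+1)-1}{r} + \mathrm{ex}_{\mathrm{star}}\left(n-st,\ n,\ s\mathbb{B}\right)$$ holds for all integers $t$ satisfying $$\frac{n}{s} - \frac{n}{16 e^2 r^4 s^2\prod_{i\in[r]} s_i} \le t \le \frac{n}{s}.$$
   Context: An $r$-graph is a set of $r$-element subsets (edges) of a finite vertex set. An $r$-partite $r$-graph with part sizes $s_1,\ldots,s_r$ has vertex set partitioned into $W_1,\ldots,W_r$ with $|W_i|=s_i$, every edge containing exactly one vertex of each $W_i$. $s\mathbb{B}$ denotes the $r$-graph consisting of $s$ pairwise vertex-disjoint copies of $\mathbb{B}$. An $n$-vertex $r$-graph $\mathcal{H}$ is an $m$-star if there is a set $V_1\subseteq V(\mathcal{H})$ with $|V_1|=m$ such that every edge of $\mathcal{H}$ contains at least one vertex of $V_1$. $\mathrm{ex}_{\mathrm{star}}(m,n,F)$ is the maximum number of edges in an $n$-vertex $r$-uniform $m$-star containing no copy of $F$. $\mathrm{ex}(n,(t+1)F)$ is the maximum number of edges in an $n$-vertex $r$-graph not containing $t+1$ pairwise vertex-disjoint copies of $F$. $e$ is Euler's number. *)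

(* Defs.v *)
From Stdlib Require Export Reals.
From mathcomp Require Export all_boot.
Set Implicit Arguments. Unset Strict Implicit. Unset Printing Implicit Defensive.

Definition uniform (T : finType) (r : nat) (H : {set {set T}}) : bool :=
  [forall e in H, #|e| == r].

Definition contains (U T : finType) (F : {set {set U}}) (H : {set {set T}}) : bool :=
  [exists f : {ffun U -> T}, injectiveb f && [forall e in F, (f @: e) \in H]].

Definition copies (U : finType) (k : nat) (F : {set {set U}}) : {set {set ('I_k * U)}} :=
  \bigcup_(i : 'I_k) [set [set (i, x) | x in e] | e : {set U} in F].

Definition is_star (T : finType) (m : nat) (H : {set {set T}}) : bool :=
  [exists V1 : {set T}, (#|V1| == m) && [forall e in H, [exists v in e, v \in V1]]].

Definition ex (U : finType) (r n : nat) (F : {set {set U}}) : nat :=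
  \max_(H : {set {set 'I_n}} | uniform r H && ~~ contains F H) #|H|.

Definition ex_star (U : finType) (r m n : nat) (F : {set {set U}}) : nat :=
  \max_(H : {set {set 'I_n}} | [&& uniform r H, is_star m H & ~~ contains F H]) #|H|.

Definition rpartite (T : finType) (r : nat) (s : 'I_r -> nat) (part : T -> 'I_r)
    (B : {set {set T}}) : Prop :=
  (forall i, #|[set x | part x == i]| = s i) /\
  (forall e, e \in B -> forall i, #|[set x in e | part x == i]| = 1).

(* Main.v *)
(* Write m = n - s t, so that m <= n / (64 r^4 s P) where P is the product of the part sizes, and let H have
   more edges than the bound. The graph H then misses at most an r m / n fraction of all r-tuples, so all but
   O(m) vertices have almost full degree. Let A be the set of vertices whose degree is below a small constant
   fraction of n^(r-1). If |A| <= m, then an m-set containing A meets more than ex_star edges, which yields s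
   disjoint copies of B, each using a vertex of that set. If |A| > m, then the edges meeting A are so numerous
   that a greedy choice gives |A| - m + s disjoint copies of B, each using a vertex of A: a greedy choice that
   gets stuck would leave a star with too few edges. Either way at most m - s vertices of A remain. The other
   vertices of defective degree have positive degree density, so Erdos' theorem on r-partite r-graphs covers
   them one by one by disjoint copies of B. Discarding m - s of the remaining vertices, including those in A,
   leaves an r-graph of nearly full minimum degree, which has a perfect B-tiling by an exchange argument of
   Daykin and Haggkvist. *)
Require Import Defs.
From Stdlib Require Import Lra.
From mathcomp Require Import zify.
Set Implicit Arguments. Unset Strict Implicit. Unset Printing Implicit Defensive.

(** * Counting tuples that span edges *)

Lemma card_set_sum (T : finType) (P : pred T) : #|[set x | P x]| = \sum_x P x.
Proof.
by rewrite cardsE -sum1_card big_mkcond; apply: eq_bigr => x _; rewrite unfold_in; case: (P x).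
Qed.

Section Counting.
Variable V : finType.
Implicit Types (Q : pred (seq V)) (H G : {set {set V}}).

(** Ordered tuples, repetitions allowed, replace edges: densities become fractions of [#|V| ^ k],
    and induction on the first entry is available. *)
Definition ntup k Q := #|[set y : k.-tuple V | Q y]|.

Lemma ntup_sum k Q : ntup k Q = \sum_(y : k.-tuple V) Q y.
Proof. exact: card_set_sum. Qed.

Lemma eq_ntup k Q Q' : (forall y, size y = k -> Q y = Q' y) -> ntup k Q = ntup k Q'.
Proof. by move=> e; rewrite /ntup; apply: eq_card => y; rewrite !inE e ?size_tuple. Qed.

Lemma leq_ntup k Q Q' : (forall y, size y = k -> Q y -> Q' y) -> ntup k Q <= ntup k Q'.
Proof.
by move=> e; apply: subset_leq_card; apply/subsetP => y; rewrite !inE; apply: e; rewrite size_tuple.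
Qed.

Lemma ntup_leU k Q Q1 Q2 : (forall y, size y = k -> Q y -> Q1 y || Q2 y) ->
  ntup k Q <= ntup k Q1 + ntup k Q2.
Proof.
move=> e; rewrite !ntup_sum -big_split; apply: leq_sum => y _ /=.
by move: (e y (size_tuple y)); case: (Q y) => // /(_ isT); case: (Q1 y); case: (Q2 y).
Qed.

Lemma ntupC k Q : ntup k Q + ntup k (predC Q) = #|V| ^ k.
Proof.
rewrite !ntup_sum -big_split /= -card_tuple -sum1_card.
by apply: eq_bigr => y _; case: (Q y).
Qed.

Lemma ntup_pred k Q : ntup k Q <= #|V| ^ k.
Proof. by rewrite -(ntupC k Q) leq_addr. Qed.

Lemma ntup0 Q : ntup 0 Q = Q [::].
Proof. by rewrite ntup_sum (bigD1 [tuple]) //= big1 ?addn0 // => y /eqP[]; apply: tuple0. Qed.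

Lemma ntupS k Q : ntup k.+1 Q = \sum_a ntup k (fun y => Q (a :: y)).
Proof.
under eq_bigr do rewrite ntup_sum.
rewrite ntup_sum pair_big /= (reindex (fun p : V * k.-tuple V => [tuple of p.1 :: p.2])) //=.
exists (fun y : k.+1.-tuple V => (thead y, [tuple of behead y])) => [[a y] _|y _] /=.
  by rewrite theadE; congr pair; apply: val_inj.
by rewrite -tuple_eta.
Qed.

Lemma ntup_has k (U : {set V}) : ntup k (has (mem U)) <= k * #|U| * #|V| ^ k.-1.
Proof.
elim: k => [|k IH]; first by rewrite ntup0.
rewrite ntupS (bigID (mem U)) /=.
apply: (@leq_trans (#|U| * #|V| ^ k + #|V| * (k * #|U| * #|V| ^ k.-1))).
  apply: leq_add; first by rewrite -sum_nat_const; apply: leq_sum => a _; apply: ntup_pred.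
  apply: (@leq_trans (\sum_(a : V) k * #|U| * #|V| ^ k.-1)); last by rewrite sum_nat_const.
  rewrite big_mkcond /=; apply: leq_sum => a _; case: ifP => // aU.
  by apply: leq_trans IH; apply: leq_ntup => y _; rewrite (negbTE aU).
rewrite mulSn mulnDl leq_add2l; case: k {IH} => [|k]; first by rewrite !mul0n muln0.
by rewrite mulnCA -expnS.
Qed.

Lemma ntup_set_eq k (e : {set V}) : #|e| = k -> ntup k (fun y => [set x in y] == e) = k`!.
Proof.
move=> ek; rewrite -ffactnn -{2}ek -card_uniq_tuples.
apply: eq_card => y; rewrite !inE.
apply/eqP/andP => [E|[/allP ae uy]].
  split; first by apply/allP => x xy; change (x \in e); rewrite -E inE.
  by apply/card_uniqP; rewrite size_tuple -cardsE E ek.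
apply/eqP; rewrite eqEcard; apply/andP; split.
  by apply/subsetP => x; rewrite inE; apply: ae.
by rewrite cardsE (card_uniqP uy) size_tuple ek.
Qed.

Lemma ntup_edges k H : uniform k H -> ntup k (fun y => [set x in y] \in H) = k`! * #|H|.
Proof.
move=> /forallP uH; rewrite ntup_sum mulnC -sum_nat_const.
rewrite (eq_bigr (fun e => ntup k (fun y => [set x in y] == e))); last first.
  by move=> e eH; rewrite ntup_set_eq //; apply/eqP; apply: (implyP (uH e)).
under eq_bigr do rewrite ntup_sum.
rewrite exchange_big /=; apply: eq_bigr => y _.
case: (boolP (_ \in H)) => yH; last first.
  by rewrite big1 // => e eH; case: eqP => // E; rewrite E eH in yH.
by rewrite (bigD1 [set x in y]) //= eqxx big1 // => e /andP[_]; rewrite eq_sym => /negbTE ->.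
Qed.

(** Degrees counted in ordered tuples. For a [k.+1]-uniform [H], a tuple that repeats an entry or
    contains [v] counts as missing. *)
Definition dg k H v := ntup k (fun y => (v |: [set x in y]) \in H).
Definition mdg k H v := ntup k (fun y => (v |: [set x in y]) \notin H).

Lemma dgK k H v : dg k H v + mdg k H v = #|V| ^ k.
Proof. exact: ntupC. Qed.

Lemma sum_mdg k H : \sum_v mdg k H v = ntup k.+1 (fun y => [set x in y] \notin H).
Proof. by rewrite ntupS; apply: eq_bigr => a _; apply: eq_ntup => y _; rewrite set_cons. Qed.

(** Exchange of summation: a tuple counts for the edge [e] at [v] exactly when it orders [e :\ v],
    and uniformity keeps [v] out of it. *)
Lemma deg_dg k H v : uniform k.+1 H -> k`! * #|[set e in H | v \in e]| = dg k H v.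
Proof.
move=> /forallP uH; rewrite /dg ntup_sum mulnC -sum_nat_const.
rewrite (eq_bigr (fun e => ntup k (fun y => [set x in y] == e :\ v))); last first.
  move=> e; rewrite inE => /andP[eH ve]; rewrite ntup_set_eq //.
  by have /eqP := implyP (uH e) eH; rewrite (cardsD1 v) ve => -[].
under eq_bigr do rewrite ntup_sum.
rewrite exchange_big /=; apply: eq_bigr => y _.
have cy : #|[set x in y]| <= k by rewrite cardsE -[leqRHS](size_tuple y) card_size.
case: (boolP (_ \in H)) => yH; last first.
  rewrite big1 // => e; rewrite inE => /andP[eH ve]; case: eqP => // E.
  by rewrite E setD1K // eH in yH.
have vy : v \notin [set x in y].
  apply/negP => vy; have /eqP := implyP (uH _) yH.
  by rewrite (setUidPr _) ?sub1set // => E; rewrite E ltnn in cy.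
rewrite (bigD1 (v |: [set x in y])) /=; last by rewrite inE yH setU11.
rewrite setU1K // eqxx big1 // => e /andP[]; rewrite inE => /andP[eH ve] ne.
by case: eqP => // E; rewrite E setD1K // eqxx in ne.
Qed.

Lemma meet_dg k G (Y : {set V}) : uniform k.+1 G ->
  k`! * #|[set e in G | ~~ [disjoint e & Y]]| <= \sum_(y in Y) dg k G y.
Proof.
move=> uG; under eq_bigr do rewrite -deg_dg //.
rewrite -big_distrr leq_mul2l; apply/orP; right.
under eq_bigr do rewrite -sum1dep_card big_mkcondr /=.
rewrite exchange_big /= -sum1dep_card big_mkcondr /=; apply: leq_sum => e eG.
case: ifP => // /pred0Pn[x /andP[/= xe xY]].
by rewrite (bigD1 x) //= xe.
Qed.

End Counting.

(** * Erdos' box theorem *)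

(** Bernoulli's inequality for [(1 - m/n)^r], cleared of denominators; truncated subtraction keeps
    it valid for [m > n]. *)
Lemma expn_sub_bernoulli n m r : n ^ r <= (n - m) ^ r + r * m * n ^ r.-1.
Proof.
elim: r => [|r IH]; first by rewrite !expn0.
have E : n ^ r.+1 <= (n - m) * n ^ r + m * n ^ r.
  by rewrite expnS -mulnDl leq_mul2r; apply/orP; right; lia.
apply: leq_trans E _; rewrite /= mulSn mulnDl addnCA addnC leq_add2l.
apply: (@leq_trans ((n - m) * ((n - m) ^ r + r * m * n ^ r.-1))); first by rewrite leq_mul2l IH orbT.
rewrite mulnDr -expnS leq_add2l; case: r {IH} => [|r]; first by rewrite !mul0n muln0.
by rewrite /= expnS mulnCA leq_mul2l [_ * n ^ r]mulnC [n * _]mulnC leq_mul2l leq_subr !orbT.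
Qed.

Lemma ffact_ge n r : (n - r.-1) ^ r <= n ^_ r.
Proof.
elim: r n => [|r IH] n; first by rewrite expn0 ffactn0.
case: n => [|n]; first by rewrite sub0n exp0n.
rewrite ffactSS expnS; apply: leq_mul; first by rewrite leq_subr.
apply: leq_trans (IH n); case: r {IH} => [|r] //; rewrite leq_exp2r //=; lia.
Qed.

Lemma ntup_all (V : finType) b (A : {set V}) : ntup b (all (mem A)) = #|A| ^ b.
Proof.
elim: b => [|b IH]; first by rewrite ntup0.
rewrite ntupS (bigID (mem A)) /= [X in _ + X]big1 ?addn0 => [|a /negbTE aA]; last first.
  by rewrite ntup_sum big1 // => y _; rewrite aA.
rewrite expnS -sum_nat_const; apply: eq_bigr => a aA; rewrite -IH.
by apply: eq_ntup => y _ /=; rewrite aA.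
Qed.

(** The injective tuples number [#|V| ^_ b], at least [(#|V| - b) ^ b], and Bernoulli bounds the
    rest. *)
Lemma ntup_dup (V : finType) b : ntup b (fun y : seq V => ~~ uniq y) <= b * b * #|V| ^ b.-1.
Proof.
have E : #|V| ^_ b + ntup b (fun y : seq V => ~~ uniq y) = #|V| ^ b.
  rewrite -(ntupC b (fun y : seq V => uniq y)) -card_uniq_tuples; congr addn.
  apply: eq_card => y; rewrite !inE.
  by case: (uniq y); rewrite ?andbF ?andbT //; apply/allP.
have := ffact_ge #|V| b; have := expn_sub_bernoulli #|V| b b.
have : (#|V| - b) ^ b <= (#|V| - b.-1) ^ b.
  by case: b {E} => // b; rewrite leq_exp2r //; lia.
move: E; set x1 := _ ^_ _; set x2 := ntup _ _; set x3 := (_ - b) ^ b; set x4 := (_ - _) ^ b.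
set x5 := #|V| ^ b; set x6 := _ * _; lia.
Qed.

(* Double count pairs (g, y) with g a b-tuple of common extensions of y; a power mean bound and
   pigeonhole produce an injective g whose common link is still dense. *)
Lemma erdos_box (r b q : nat) : exists n0, forall (V : finType), n0 <= #|V| ->
  forall Q : pred (seq V), #|V| ^ r <= q * ntup r Q ->
  exists S : seq {set V}, [/\ size S = r, all (fun A : {set V} => #|A| == b) S
    & forall y, all2 (fun a (A : {set V}) => a \in A) y S -> Q y].
Proof.
elim: r q => [|r IH] q.
  exists 0 => V _ Q; rewrite ntup0 expn0 => h; exists [::]; split=> // -[|//] _.
  by case: (Q _) h; rewrite ?muln0.
(* One factor [2 * q] pays for the share of [y] with at least [n / (2 * q)] extensions, the other
   [b] for the [b]-th power of that number. *)
pose K := (2 * q) ^ b.+1.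
have [n1 {}IH] := IH (4 * K).
exists (n1 + 2 * K * (b * b) + 1) => V nV Q hQ.
set n := #|V| in nV hQ *.
have n_gt0 : 0 < n by lia.
pose N (y : seq V) := #|[set a | Q (a :: y)]|.
pose f (g : seq V) := ntup r (fun y => all (fun a => Q (a :: y)) g).
have hN : ntup r.+1 Q = \sum_(y : r.-tuple V) N y.
  rewrite ntupS; under eq_bigr do rewrite ntup_sum.
  by rewrite exchange_big; apply: eq_bigr => y _; rewrite /N card_set_sum.
pose Y1 := ntup r (fun y => n <= 2 * q * N y).
have hY1 : n ^ r <= 2 * q * Y1.
  have : 2 * q * ntup r.+1 Q <= 2 * q * n * Y1 + n ^ r * n.
    rewrite hN -card_tuple -sum_nat_const /Y1 ntup_sum !big_distrr -big_split /=.
    apply: leq_sum => y _; have Nn : N y <= n by apply: max_card.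
    case: (leqP n (2 * q * N y)) => /= h; last lia.
    by rewrite muln1; apply: leq_trans (leq_addr _ _); rewrite leq_mul2l Nn orbT.
  move: hQ; rewrite expnS => hQ hh.
  rewrite -(leq_pmul2l n_gt0); nia.
have hf : n ^ (r + b) <= K * \sum_(g : b.-tuple V) f g.
  have -> : \sum_(g : b.-tuple V) f g = \sum_(y : r.-tuple V) N y ^ b.
    rewrite /f; under eq_bigr do rewrite ntup_sum.
    rewrite exchange_big; apply: eq_bigr => y _ /=.
    rewrite /N -ntup_all ntup_sum; apply: eq_bigr => g _; congr nat_of_bool.
    by apply: eq_all => a; rewrite /= inE.
  apply: (@leq_trans (2 * q * Y1 * n ^ b)); first by rewrite expnD leq_mul2r hY1 orbT.
  rewrite /K expnS -!mulnA !leq_mul2l; apply/orP; right; apply/orP; right.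
  rewrite /Y1 ntup_sum mulnC !big_distrr; apply: leq_sum => y _ /=.
  case: (leqP n (2 * q * N y)) => /= h; last by rewrite muln0.
  by rewrite muln1 -expnMn; case: (b) => // b'; rewrite leq_exp2r.
(* Otherwise the injective [g] carry at most a quarter of the weight that [hf] demands, and the
   others at most half of it, since [n] exceeds [2 * K * (b * b)]. *)
have [g ug hg] : exists2 g : b.-tuple V, uniq g & n ^ r <= 4 * K * f g.
  have [/exists_inP//|/exists_inPn h] :=
    boolP [exists (g : b.-tuple V | uniq g), n ^ r <= 4 * K * f g].
  have h1 : \sum_(g : b.-tuple V | uniq g) 4 * K * f g <= n ^ b * n ^ r.
    rewrite -card_tuple -sum_nat_const big_mkcond /=; apply: leq_sum => g _.
    by case: ifP => // ug; apply/ltnW; rewrite ltnNge; apply: h.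
  have h2 : \sum_(g : b.-tuple V | ~~ uniq g) f g <= b * b * n ^ b.-1 * n ^ r.
    apply: (@leq_trans (ntup b (fun y : seq V => ~~ uniq y) * n ^ r)); last first.
      by rewrite leq_mul2r ntup_dup orbT.
    rewrite ntup_sum big_distrl /= big_mkcond /=; apply: leq_sum => g _.
    by case: ifP => // _; rewrite mul1n; apply: ntup_pred.
  have h3 : 2 * K * (b * b * n ^ b.-1 * n ^ r) <= n ^ b * n ^ r.
    rewrite !mulnA leq_mul2r; apply/orP; right.
    case: (b) nV => [|b'] nV /=; first by rewrite !(muln0, mul0n).
    by rewrite expnS leq_mul2r; apply/orP; right; rewrite -!mulnA in nV *; lia.
  move: hf; rewrite (bigID (fun g : b.-tuple V => uniq g)) /= expnD.
  rewrite -big_distrr /= in h1.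
  have M_gt0 : 0 < n ^ b * n ^ r by rewrite muln_gt0 !expn_gt0 n_gt0.
  have := leq_mul (leqnn (2 * K)) h2.
  set S2 := \sum_(g : b.-tuple V | ~~ _) _; move: h1 h3 M_gt0; rewrite [n ^ r * _]mulnC mulnDr.
  set S1 := \sum_(g : b.-tuple V | _) _; set M := _ * n ^ r; set Z := _ * n ^ r.
  rewrite -!mulnA; set KS1 := K * S1; set KS2 := K * S2; lia.
have [S [sS aS hS]] := IH V (ltac:(lia)) _ hg.
exists ([set x in g] :: S); split=> /=; first by rewrite sS.
  by rewrite aS cardsE (card_uniqP ug) size_tuple eqxx.
case=> // a y /= /andP[ag /hS /allP]; apply; by rewrite inE in ag.
Qed.

(** * Tilings and covering a vertex *)

Section Tilings.
Variables (T V : finType) (B : {set {set T}}).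
Implicit Types (H G : {set {set V}}) (X Y U A : {set V}).

(** [X] records all vertices of the [k] disjoint copies, images of isolated vertices of [B]
    included, so its size is exactly [k * #|T|]. *)
Definition tiled H (k : nat) X := exists f : 'I_k * T -> V,
  [/\ injective f, forall i e, e \in B -> [set f (i, x) | x in e] \in H & X = f @: setT].

Lemma tiled0 H : tiled H 0 set0.
Proof.
exists (fun z : 'I_0 * T => match z.1 with Ordinal i lt => False_rect V (notF lt) end).
split=> [[[]]//|[]//|]; apply/esym/setP => v; rewrite inE.
by apply/negbTE/negP => /imsetP[[[]]].
Qed.

Lemma tiled_card H k X : tiled H k X -> #|X| = k * #|T|.
Proof. by case=> f [fi _ ->]; rewrite card_imset // cardsT card_prod card_ord. Qed.

Lemma tiled_sub G H k X : G \subset H -> tiled G k X -> tiled H k X.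
Proof. by move=> /subsetP GH [f [fi fB ->]]; exists f; split=> // i e /(fB i) /GH. Qed.

Lemma tiledU H k l X Y : tiled H k X -> tiled H l Y -> [disjoint X & Y] ->
  tiled H (k + l) (X :|: Y).
Proof.
move=> [f [fi fB XE]] [g [gi gB YE]] dXY.
pose h (z : 'I_(k + l) * T) := match split z.1 with inl i => f (i, z.2) | inr i => g (i, z.2) end.
have fX z : f z \in X by rewrite XE imset_f.
have gY z : g z \in Y by rewrite YE imset_f.
have fg z z' : f z <> g z'.
  by move=> E; move/pred0P: dXY => /(_ (f z)); rewrite /= fX E gY.
exists h; split.
- move=> [i x] [j y]; rewrite /h /=.
  rewrite -{2}(splitK i) -{2}(splitK j).
  case: (split i) => i'; case: (split j) => j' /=.
  + by move=> /fi [-> ->].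
  + by move=> /fg.
  + by move=> /esym/fg.
  + by move=> /gi [-> ->].
- by move=> i e eB; rewrite /h /=; case: (split i) => i'; [apply: fB|apply: gB].
- apply/setP => v; rewrite inE XE YE; apply/orP/imsetP.
    case=> /imsetP[[i x] _ ->].
      by exists (unsplit (inl i), x) => //; rewrite /h unsplitK.
    by exists (unsplit (inr i), x) => //; rewrite /h unsplitK.
  move=> [[i x] _ ->]; rewrite /h /=; case: (split i) => i'; [left|right]; exact: imset_f.
Qed.

Lemma tiled1 H (f : T -> V) : injective f -> (forall e, e \in B -> f @: e \in H) ->
  tiled H 1 (f @: setT).
Proof.
move=> fi fB; exists (fun z => f z.2); split=> [[i x] [j y] /fi /= ->|//|].
  by rewrite [i]ord1 [j]ord1.
apply/setP => v; apply/imsetP/imsetP => [[x _ ->]|[[i x] _ ->]]; last by exists x.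
by exists (ord0, x).
Qed.

Lemma tiled_contains H k X : tiled H k X -> contains (copies k B) H.
Proof.
move=> [f [fi fB _]]; apply/existsP; exists (finfun f); apply/andP; split.
  by apply/injectiveP => z z'; rewrite !ffunE => /fi.
apply/forall_inP => e /bigcupP[i _ /imsetP[e' e'B ->]].
rewrite -imset_comp; have := fB i _ e'B; congr (_ \in H).
by apply: eq_imset => x /=; rewrite ffunE.
Qed.

Lemma contains_tiled H k : contains (copies k B) H -> exists X, tiled H k X.
Proof.
move=> /existsP[f /andP[/injectiveP fi /forall_inP fB]].
exists (f @: setT); exists f; split=> // i e eB.
have -> : [set f (i, x) | x in e] = f @: [set (i, x) | x in e] by rewrite -imset_comp.
by apply: fB; apply/bigcupP; exists i => //; apply: imset_f.
Qed.

(** Each copy contains an edge since [B] has one, hence a vertex of [A]; the copies are disjoint, so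
    these vertices differ. *)
Lemma tiled_star G A k X : B != set0 -> (forall e, e \in G -> ~~ [disjoint e & A]) ->
  tiled G k X -> k <= #|X :&: A|.
Proof.
move=> /set0Pn[e eB] GA [f [fi fB XE]].
have hx i : exists x, f (i, x) \in A.
  have /pred0Pn[v /andP[/imsetP[x _ ->] xA]] := GA _ (fB i _ eB).
  by exists x.
pose g i := f (i, xchoose (hx i)).
have gi : injective g by move=> i j /fi [].
rewrite -[k]card_ord -cardsT -(card_imset _ gi); apply/subset_leq_card/subsetP => v.
by move=> /imsetP[i _ ->]; rewrite inE (xchooseP (hx i)) andbT XE; apply: imset_f.
Qed.

Lemma tiled_leq H k l X : k <= l -> tiled H l X -> exists Y, tiled H k Y.
Proof.
move=> kl [f [fi fB _]]; pose g (z : 'I_k * T) := f (widen_ord kl z.1, z.2).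
exists (g @: setT), g; split=> // [[i x] [j y] /fi [E ->]|i e eB]; last exact: (fB (widen_ord kl i) e eB).
by congr pair; apply: val_inj.
Qed.

Variables (k : nat) (part : T -> 'I_k.+1) (x0 : T).
Hypothesis partB : forall e, e \in B -> forall i, #|[set x in e | part x == i]| = 1.
Hypothesis x0P : part x0 = ord0.

(* The box sits in the r-tuples y such that y is an edge, y with its first entry replaced by u is an edge,
   and y avoids U; so u may take over the role of a vertex in the first part. *)
Lemma box_cover H U u (S : seq {set V}) : uniform k.+1 H -> u \notin U ->
  size S = k.+1 -> all (fun A : {set V} => #|A| == #|T|) S ->
  (forall y, all2 (fun a (A : {set V}) => a \in A) y S ->
     [&& [set x in y] \in H, (u |: [set x in behead y]) \in H & ~~ has (mem (u |: U)) y]) ->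
  exists f : T -> V, [/\ injective f, forall e, e \in B -> f @: e \in H,
    u \in f @: setT & [disjoint f @: setT & U]].
Proof.
move=> uH uU sS aS hS.
pose Sf i := nth set0 S i.
have cS (i : 'I_k.+1) : #|Sf i| = #|T|.
  by apply/eqP/(all_nthP set0 aS); rewrite sS.
have hg (g : 'I_k.+1 -> V) : (forall i, g i \in Sf i) ->
  [/\ [set x in codom g] \in H, (u |: [set g (lift ord0 j) | j : 'I_k]) \in H &
      forall i, g i \notin u |: U].
  move=> gS; have {}/hS : all2 (fun a (A : {set V}) => a \in A) (codom g) S.
    have -> : S = [seq Sf (val i) | i : 'I_k.+1 <- enum 'I_k.+1].
      by rewrite (map_comp (nth set0 S) val) val_enum_ord -sS; apply/esym/mkseq_nth.
    by rewrite codomE; elim: (enum _) => //= i l ->; rewrite gS.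
  move=> /and3P[-> h /hasPn h']; split=> // [|i]; last by apply: h'; apply: codom_f.
  move: h; rewrite codomE enum_ordSl /= -map_comp; congr (_ |: _ \in H).
  apply/setP => v; rewrite inE; apply/mapP/imsetP => -[j _ ->]; exists j => //.
  by rewrite mem_enum.
(* Each part is placed in its class by rank in [T]; a class has [#|T|] elements, so the default [u]
   is never reached. *)
pose f0 x := nth u (enum (Sf (part x))) (enum_rank x).
have f0S x : f0 x \in Sf (part x).
  by rewrite -mem_enum mem_nth // -cardE cS ltn_ord.
pose g0 (i : 'I_k.+1) := nth u (enum (Sf i)) 0.
have g0S i : g0 i \in Sf i.
  by rewrite -mem_enum mem_nth // -cardE cS; apply/card_gt0P; exists x0.
(* A vertex in two classes would give a transversal with a repeated entry, too small to be an
   edge. *)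
have Sdisj (i j : 'I_k.+1) z : z \in Sf i -> z \in Sf j -> i = j.
  move=> zi zj; pose g l := if (l == i) || (l == j) then z else g0 l.
  have [] := hg g.
    by move=> l; rewrite /g; case: eqP => [->|_] //=; case: eqP => [->|_].
  move=> /(forall_inP uH) c _ _.
  have : #|g @: setT| == #|[set: 'I_k.+1]|.
    rewrite cardsT card_ord; apply/eqP; apply: etrans (eqP c); apply: eq_card => v; rewrite inE.
    by apply/imsetP/codomP => [[l _ ->]|[l ->]]; exists l.
  by move=> /imset_injP; apply; rewrite ?inE // /g !eqxx orbT.
have f0U x : f0 x \notin u |: U.
  pose g l := if l == part x then f0 x else g0 l.
  have [] := hg g; first by move=> l; rewrite /g; case: eqP => [->|_].
  by move=> _ _ /(_ (part x)); rewrite /g eqxx.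
have f0u x : f0 x <> u by move=> E; have := f0U x; rewrite E setU11.
have f0i : injective f0.
  move=> x y E; have P : part x = part y.
    by apply: (@Sdisj _ _ (f0 x)); rewrite // E.
  move/eqP: E; rewrite /f0 P nth_uniq ?enum_uniq // -?cardE ?cS ?ltn_ord //.
  by move=> /eqP/val_inj/enum_rank_inj.
pose f x := if x == x0 then u else f0 x.
exists f; split.
- move=> x y; rewrite /f; case: eqP => [->|_]; case: eqP => [->|_] //.
  + by move=> /esym/f0u.
  + by move=> /f0u.
  + exact: f0i.
(* An edge has one vertex in each part, so [f0] maps it to the transversal [ge]. If it contains
   [x0], then [f] changes the entry at [ord0] to [u], which is the second kind of edge the box
   provides. *)
- move=> e eB; pose ge i := f0 (odflt x0 [pick x in e | part x == i]).
  have geE x : x \in e -> ge (part x) = f0 x.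
    move=> xe; rewrite /ge; case: pickP => [y /andP[ye /eqP yP]|/(_ x)]; last by rewrite xe eqxx.
    have /eqP/cards1P[z zE] := partB eB (part x).
    have : x \in [set z] by rewrite -zE inE xe eqxx.
    have : y \in [set z] by rewrite -zE inE ye yP eqxx.
    by rewrite !inE /= => /eqP -> /eqP ->.
  have geP i : exists2 x, x \in e & part x = i.
    have /eqP/cards1P[z zE] := partB eB i.
    have : z \in [set x in e | part x == i] by rewrite zE set11.
    by rewrite inE => /andP[ze /eqP]; exists z.
  have [|h1 h2 _] := hg ge.
    by move=> i; have [x xe <-] := geP i; rewrite geE.
  have [x0e|x0e] := boolP (x0 \in e); last first.
    move: h1; congr (_ \in H); apply/setP => v; rewrite inE; apply/codomP/imsetP.
      move=> [i ->]; have [x xe <-] := geP i; exists x; rewrite ?geE // /f.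
      by case: eqP => // E; rewrite -E xe in x0e.
    move=> [x xe ->]; exists (part x); rewrite geE // /f.
    by case: eqP => // E; rewrite -E xe in x0e.
  move: h2; congr (_ \in H); apply/setP => v; rewrite !inE; apply/orP/imsetP.
    case=> [/eqP ->|/imsetP[j _ ->]]; first by exists x0 => //; rewrite /f eqxx.
    have [x xe E] := geP (lift ord0 j); exists x => //; rewrite -E geE // /f.
    by case: eqP => // Ex; move: E; rewrite Ex x0P => /eqP; rewrite eq_liftF.
  move=> [x xe ->]; rewrite /f; case: (x =P x0) => [_|/eqP ne]; [by left|right].
  have : part x != ord0.
    apply: contra_neq ne => px; apply: f0i; rewrite -!geE // px x0P //.
  by rewrite eq_sym => /unlift_some[j E _]; apply/imsetP; exists j; rewrite // -E geE.
- by apply/imsetP; exists x0 => //; rewrite /f eqxx.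
- apply/pred0P => v /=; apply/negbTE/negP => /andP[/imsetP[x _ ->]]; rewrite /f.
  case: eqP => _ h; first by rewrite h in uU.
  by have := f0U x; rewrite inE h orbT.
Qed.

End Tilings.

(** [#|V| * dg k H u] counts the tuples whose tail forms an edge with [u], the first entry being
    free. Once those that span no edge or meet [u |: U] are removed, a fraction [1 / q] of all
    tuples remains for the box theorem. *)
Lemma cover_vertex (T : finType) (B : {set {set T}}) k (part : T -> 'I_k.+1) (x0 : T) q :
  (forall e, e \in B -> forall i, #|[set x in e | part x == i]| = 1) -> part x0 = ord0 ->
  exists n0, forall V : finType, n0 <= #|V| -> forall (H : {set {set V}}) (U : {set V}) u,
  uniform k.+1 H -> u \notin U ->
  #|V| ^ k.+1 + q * (ntup k.+1 (fun y => [set x in y] \notin H) + k.+1 * #|U|.+1 * #|V| ^ k)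
    <= q * (#|V| * dg k H u) ->
  exists f : T -> V, [/\ injective f, forall e, e \in B -> f @: e \in H,
    u \in f @: setT & [disjoint f @: setT & U]].
Proof.
move=> partB x0P; have [n0 hn0] := erdos_box k.+1 #|T| q; exists n0 => V nV H U u uH uU hd.
pose Q (y : seq V) := [&& [set x in y] \in H, (u |: [set x in behead y]) \in H
  & ~~ has (mem (u |: U)) y].
have [|S [sS aS hS]] := hn0 V nV Q; last exact: (box_cover partB x0P uH uU sS aS hS).
have E : #|V| * dg k H u = ntup k.+1 (fun y => (u |: [set x in behead y]) \in H).
  by rewrite ntupS /= sum_nat_const.
have h1 : #|V| * dg k H u <= ntup k.+1 Q +
    (ntup k.+1 (fun y => [set x in y] \notin H) + ntup k.+1 (has (mem (u |: U)))).
  rewrite E; apply: leq_trans (leq_add (leqnn _) (ntup_leU (Q := fun y => ([set x in y] \notin H) ||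
    has (mem (u |: U)) y) _)); last by [].
  by apply: ntup_leU => y _ hy; rewrite /Q hy /=; case: (_ \in H); case: (has _ y).
have := ntup_has k.+1 (u |: U); rewrite cardsU1 uU add1n /= => h2.
have : q * (#|V| * dg k H u) <= q * (ntup k.+1 Q +
    (ntup k.+1 (fun y => [set x in y] \notin H) + k.+1 * #|U|.+1 * #|V| ^ k)).
  by rewrite leq_mul2l; apply/orP; right; apply: leq_trans h1 _; rewrite !leq_add2l.
by rewrite mulnDr => h3; have := leq_trans hd h3; rewrite leq_add2r.
Qed.

(** * Perfect tilings *)

(** Addition modulo [#|T|], carried over along [enum_rank], with [z] as zero. *)
Lemma latin_square (T : finType) (x0 : T) : exists (z : T) (ad : T -> T -> T),
  [/\ forall c, ad c z = c, forall c, injective (ad c) & forall y, injective (ad^~ y)].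
Proof.
have T0 : 0 < #|T| by apply/card_gt0P; exists x0.
pose ad (x y : T) := enum_val (Ordinal (ltn_pmod (enum_rank x + enum_rank y) T0)).
exists (enum_val (Ordinal T0)), ad; split=> [c|c x y|y c d] /=.
- apply: enum_rank_inj; apply: val_inj; rewrite /ad !enum_valK /= addn0 modn_small //.
- move=> /enum_val_inj/(congr1 val)/eqP/=; rewrite eqn_modDl !modn_small //.
  by move=> /eqP/val_inj/enum_rank_inj.
- move=> /enum_val_inj/(congr1 val)/eqP/=; rewrite eqn_modDr !modn_small //.
  by move=> /eqP/val_inj/enum_rank_inj.
Qed.

(** The event depends only on the restriction of [w] to [l]; the remaining values are free. *)
Lemma ffun_event_le (T X : finType) (l : seq T) (Q : pred (seq X)) : uniq l ->
  \sum_(w : {ffun T -> X}) Q [seq w p | p <- l] <= ntup (size l) Q * #|X| ^ (#|T| - size l).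
Proof.
move=> ul; pose l' := enum [set p | p \notin l].
have sl' : size l' = #|T| - size l.
  rewrite -cardE; have -> : [set p | p \notin l] = ~: [set p in l] by apply/setP=> p; rewrite !inE.
  by rewrite cardsCs setCK cardsE (card_uniqP ul).
pose h (w : {ffun T -> X}) := ([tuple of [seq w p | p <- in_tuple l]], [tuple of [seq w p | p <- in_tuple l']]).
have hi : injective h.
  move=> w w' [/eq_in_map E1 /eq_in_map E2]; apply/ffunP => p.
  by case: (boolP (p \in l)) => pl; [apply: E1|apply: E2; rewrite mem_enum inE].
rewrite -card_set_sum -(card_imset _ hi) -sl' -card_tuple -cardsT /ntup -cardsX.
apply/subset_leq_card/subsetP => z /imsetP[w]; rewrite inE => hw ->.
by rewrite !inE /= hw.
Qed.

Lemma ntup_map (X V : finType) (g : X -> V) k (Q : pred (seq V)) : injective g ->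
  ntup k (fun y => Q (map g y)) <= ntup k Q.
Proof.
move=> gi; have mi : injective (fun y : k.-tuple X => [tuple of map g y]).
  by move=> y y' [] /(inj_map gi) /val_inj.
rewrite /ntup -(card_imset _ mi); apply/subset_leq_card/subsetP => z /imsetP[y].
by rewrite !inE => hy ->.
Qed.

(** First moment method: natural numbers with mean below 1 include a zero. *)
Lemma exists_sum0 (I : finType) (F : I -> nat) : \sum_i F i < #|I| -> exists i, F i = 0.
Proof.
move=> h; suff /existsP[i /eqP] : [exists i, F i == 0] by exists i.
apply: contraTT h; rewrite negb_exists -leqNgt -sum1_card => /forallP h.
by apply: leq_sum => i _; rewrite lt0n.
Qed.

(** The degrees sum to [r * #|B|], so a vertex of minimum degree works. In the exchange it receives
    the vertices of the bad copy, so that few edges pass through them. *)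
Lemma low_degree_vertex (T : finType) (x0 : T) (B : {set {set T}}) r :
  (forall e, e \in B -> #|e| = r) ->
  exists q : T, #|T| * #|[set e in B | q \in e]| <= r * #|B|.
Proof.
move=> Br; pose d q := #|[set e in B | q \in e]|.
exists [arg min_(q < x0) d q]; case: arg_minnP => // q _ hq.
rewrite -/(d q) -sum_nat_const; apply: (@leq_trans (\sum_p d p)).
  by apply: leq_sum => p _; apply: hq.
rewrite /d; under eq_bigr do rewrite -sum1dep_card big_mkcondr /=.
rewrite exchange_big /= mulnC -sum_nat_const leq_eqVlt; apply/orP; left; apply/eqP.
by apply: eq_bigr => e /Br <-; rewrite -big_mkcond sum1_card.
Qed.

(** The [Si] bound the failures summed over all [N ^ s] choices. Dividing by [N ^ (s - k.+1)] leaves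
    the hypothesis; its [s ^ 3] is [s * s.-1 * s + s * s], from [S1] and [S2] together. *)
Lemma exchange_arith s N k b d mu nu S1 S2 S3 S4 : k < s -> s * d <= k.+1 * b ->
  s ^ 3 * N ^ k + s * b * mu + k.+1 * b * N * nu < N ^ k.+1 ->
  S1 <= s * s.-1 * (s * N ^ s.-1) -> S2 <= s * (s * N ^ s.-1) ->
  S3 <= s * b * (mu * N ^ (s - k.+1)) -> S4 <= s * d * (nu * N ^ (s - k)) ->
  S1 + S2 + S3 + S4 < N ^ s.
Proof.
move=> ks hd hN h1 h2 h3 h4.
have N_gt0 : 0 < N by rewrite lt0n; apply: contraTneq hN => ->; rewrite [X in _ < X]exp0n // ltn0.
have [M [sM M_gt0]] : exists M, N ^ s = N ^ k.+1 * M /\ (0 < M /\ M = N ^ (s - k.+1)).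
  by exists (N ^ (s - k.+1)); rewrite -expnD subnKC // expn_gt0 N_gt0.
case: M_gt0 => M_gt0 EM; rewrite -EM in h3.
have E1 : N ^ s.-1 = N ^ k * M by rewrite EM -expnD; congr (_ ^ _); lia.
have E2 : N ^ (s - k) = N * M by rewrite EM -expnS; congr (_ ^ _); lia.
rewrite E1 in h1 h2; rewrite E2 in h4; rewrite sM.
apply: leq_ltn_trans (_ : (s ^ 3 * N ^ k + s * b * mu + k.+1 * b * N * nu) * M < _); last first.
  by rewrite ltn_pmul2r.
rewrite mulnDl mulnDl; apply: leq_add; first apply: leq_add.
- have -> : s ^ 3 * N ^ k * M = s * s.-1 * (s * (N ^ k * M)) + s * (s * (N ^ k * M)).
    by rewrite -mulnDl -mulnSr prednK ?(leq_ltn_trans (leq0n k) ks) // !expnS expn0 muln1 !mulnA.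
  exact: leq_add.
- by rewrite -mulnA.
- apply: leq_trans h4 _; have E : k.+1 * b * N * nu * M = k.+1 * b * (nu * (N * M)).
    by rewrite -!mulnA (mulnCA N nu).
  by rewrite E leq_mul2r hd orbT.
Qed.

Section Exchange.
Variables (T V : finType) (B : {set {set T}}) (H : {set {set V}}) (k K : nat).
Variables (f : 'I_K * T -> V) (i0 : 'I_K) (mu nu : nat).
Hypothesis Br : forall e, e \in B -> #|e| = k.+1.
Hypothesis fi : injective f.
Hypothesis fB : forall i, i != i0 -> forall e, e \in B -> [set f (i, x) | x in e] \in H.
Hypothesis hmu : ntup k.+1 (fun y => [set x in y] \notin H) <= mu.
Hypothesis hnu : forall x, mdg k H (f (i0, x)) <= nu.
Hypothesis hN : #|T| ^ 3 * (K * #|T|) ^ k + #|T| * #|B| * mu + k.+1 * #|B| * (K * #|T|) * nu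
  < (K * #|T|) ^ k.+1.
Hypothesis B0 : B != set0.

(* Break up the bad copy i0 together with random copies, one for each position p other than q, and form
   |T| new copies: the c-th one has the c-th vertex of copy i0 at position q and one vertex of each other
   broken copy, the Latin square making the new copies disjoint. *)
Lemma exchange : tiled B H K (f @: setT).
Proof.
set s := #|T|; set N := K * s.
have hNs : s ^ 3 * N ^ k + s * #|B| * mu + k.+1 * #|B| * N * nu < N ^ k.+1 := hN.
have [e0 e0B] := set0Pn _ B0.
have [x0 x0e] : exists x0, x0 \in e0 by apply/set0Pn; rewrite -card_gt0 Br.
have ks : k < s by rewrite -(Br e0B) max_card.
have [z [ad [adz adi adi']]] := latin_square x0.
have [q hq] := low_degree_vertex x0 Br.
pose X := ('I_K * T)%type.
have cX : #|{: X}| = N by rewrite card_prod card_ord.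
pose sh c (a : X) : X := (a.1, ad c a.2).
have shi c : injective (sh c) by move=> [i x] [j y] [/= -> /adi ->].
(* The bad events for a choice [w]: two positions in one copy ([F1]), a position in the bad copy
   ([F2]), a missing edge among the shifted vertices ([F3]), a missing edge through a vertex of the
   bad copy placed at [q] ([F4]). *)
pose F1 (w : {ffun T -> X}) := \sum_(pp : T * T | pp.1 != pp.2) ((w pp.1).1 == (w pp.2).1).
pose F2 (w : {ffun T -> X}) := \sum_(p : T) ((w p).1 == i0).
pose Q3 c (y : seq X) := [set x in [seq f (sh c a) | a <- y]] \notin H.
pose F3 (w : {ffun T -> X}) := \sum_(c : T) \sum_(e in B) (Q3 c [seq w p | p <- enum e] : nat).
pose Q4 c (y : seq X) := (f (i0, c) |: [set x in [seq f (sh c a) | a <- y]]) \notin H.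
pose F4 (w : {ffun T -> X}) :=
  \sum_(c : T) \sum_(e in [set e in B | q \in e]) (Q4 c [seq w p | p <- enum (e :\ q)] : nat).
have [w /eqP] : exists w, F1 w + F2 w + F3 w + F4 w = 0.
  apply: exists_sum0; rewrite !big_split /= card_ffun cX.
  have h1 : \sum_w F1 w <= s * s.-1 * (s * N ^ s.-1).
    rewrite /F1 exchange_big /=.
    have -> : s * s.-1 = #|[set pp : T * T | pp.1 != pp.2]|.
      have := cardsCs [set pp : T * T | pp.1 != pp.2].
      have -> : ~: [set pp : T * T | pp.1 != pp.2] = (fun x => (x, x)) @: [set: T].
        apply/setP => -[x y]; rewrite !inE negbK /=; apply/eqP/imsetP => [->|[a _ [-> ->]]] //.
        by exists y.
      rewrite card_imset ?cardsT; last by move=> x y [].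
      by rewrite card_prod -/s => ->; rewrite -subn1 mulnBr muln1.
    rewrite -sum_nat_const; under [leqRHS]eq_bigl do rewrite inE.
    apply: leq_sum => -[p p'] /= pp'.
    have u2 : uniq [:: p; p'] by rewrite /= inE pp'.
    have := ffun_event_le (fun y : seq X => if y is [:: a; b] then a.1 == b.1 else false) u2.
    move=> /= h; apply: leq_trans h _; rewrite cX -/s !ntupS.
    under eq_bigr do rewrite ntupS; under eq_bigr do under eq_bigr do rewrite ntup0.
    have -> : \sum_(a : X) \sum_(b : X) (a.1 == b.1 : nat) = N * s.
      rewrite -cX -sum_nat_const; apply: eq_bigr => -[i x] _ /=.
      rewrite -(pair_bigA _ (fun (j : 'I_K) (y : T) => (i == j) : nat)) /=.
      rewrite (bigD1 i) //= eqxx sum1_card big1 ?addn0 // => j.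
      by rewrite eq_sym => /negbTE ->; rewrite big1.
    have s2 : 1 < s by have := max_card (mem [set p; p']); rewrite cards2 pp'.
    by rewrite [N * s]mulnC -mulnA leq_mul2l -expnS (subnSK s2) subn1 leqnn orbT.
  have h2 : \sum_w F2 w <= s * (s * N ^ s.-1).
    rewrite /F2 exchange_big /= -sum_nat_const; apply: leq_sum => p _.
    have := @ffun_event_le _ _ [:: p] (fun y : seq X => if y is [:: a] then a.1 == i0 else false) isT.
    move=> /= h; apply: leq_trans h _; rewrite cX -/s ntupS subn1 leq_mul2r; apply/orP; right.
    under eq_bigr do rewrite ntup0.
    rewrite -(pair_bigA _ (fun (j : 'I_K) (y : T) => (j == i0) : nat)) /=.
    rewrite (bigD1 i0) //= eqxx sum1_card big1 ?addn0 // => j.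
    by move=> /negbTE ->; rewrite big1.
  have h3 : \sum_w F3 w <= s * #|B| * (mu * N ^ (s - k.+1)).
    rewrite /F3 exchange_big /= -mulnA -sum_nat_const; apply: leq_sum => c _.
    rewrite exchange_big /= -sum_nat_const; apply: leq_sum => e eB.
    apply: leq_trans (ffun_event_le (Q3 c) (enum_uniq _)) _.
    rewrite -cardE Br // cX leq_mul2r; apply/orP; right; apply: leq_trans hmu.
    apply: (@ntup_map _ _ (fun a => f (sh c a)) _ (fun y => [set x in y] \notin H)).
    by move=> a b /fi /shi.
  have h4 : \sum_w F4 w <= s * #|[set e in B | q \in e]| * (nu * N ^ (s - k)).
    rewrite /F4 exchange_big /= -mulnA -sum_nat_const; apply: leq_sum => c _.
    rewrite exchange_big /= -sum_nat_const; apply: leq_sum => e; rewrite inE => /andP[eB qe].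
    apply: leq_trans (ffun_event_le (Q4 c) (enum_uniq _)) _.
    have : #|e| = k.+1 by apply: Br.
    rewrite (cardsD1 q) qe add1n => -[ek]; rewrite -cardE ek cX leq_mul2r; apply/orP; right.
    apply: leq_trans (hnu c).
    apply: (@ntup_map _ _ (fun a => f (sh c a)) _ (fun y => (f (i0, c) |: [set x in y]) \notin H)).
    by move=> a b /fi /shi.
  exact: (exchange_arith ks hq hNs h1 h2 h3 h4).
rewrite !addn_eq0 => /andP[/andP[/andP[]]]; rewrite !sum_nat_eq0.
move=> /forall_inP h1 /forall_inP h2 /forall_inP h3 /forall_inP h4.
have {}h1 p p' : p != p' -> (w p).1 != (w p').1 by move=> /(h1 (p, p')); rewrite eqb0.
have {}h2 p : (w p).1 != i0 by have := h2 p isT; rewrite eqb0.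
have {}h3 c e : e \in B -> [set f (sh c (w p)) | p in e] \in H.
  move=> eB; have := h3 c isT; rewrite sum_nat_eq0 => /forall_inP/(_ e eB).
  rewrite eqb0 negbK; congr (_ \in H); apply/setP => v; rewrite inE -map_comp.
  by apply/mapP/imsetP => -[p pe ->]; exists p => //; rewrite mem_enum in pe *.
have {}h4 c e : e \in B -> q \in e -> f (i0, c) |: [set f (sh c (w p)) | p in e :\ q] \in H.
  move=> eB qe; have := h4 c isT; rewrite sum_nat_eq0 => /forall_inP/(_ e).
  rewrite inE eB qe eqb0 negbK => /(_ isT).
  congr (_ |: _ \in H); apply/setP => v; rewrite inE -map_comp.
  by apply/mapP/imsetP => -[p pe ->]; exists p => //; rewrite mem_enum in pe *.
(* Since [ad c z = c], the shift by [c] puts the [c]-th vertex of the bad copy at position [q] of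
   the [c]-th new copy. *)
pose w' p := if p == q then (i0, z) else w p.
have ji : injective (fun p => (w' p).1).
  move=> p p'; rewrite /w'; case: eqP => [->|_]; case: eqP => [->|_] //= E.
  - by have := h2 p'; rewrite -E eqxx.
  - by have := h2 p; rewrite E eqxx.
  - by apply/eqP; apply: contraT => /h1; rewrite E eqxx.
(* The broken copy chosen for position [c] passes its index to the [c]-th new copy; unbroken copies
   stay. This permutes [X], so the same vertices are covered. *)
pose pi (a : X) : X := if [pick c | (w' c).1 == a.1] is Some c then sh c (w' a.2) else a.
have pii : injective pi.
  move=> [i p] [i' p']; rewrite /pi /=.
  case: pickP => [c /eqP cE|n1]; case: pickP => [c' /eqP cE'|n2].
  - by move=> [/ji E1]; rewrite E1 => /adi' E2; rewrite -cE -cE' E2.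
  - by move=> [E _]; have := n2 p; rewrite E eqxx.
  - by move=> [E _]; have := n1 p'; rewrite E eqxx.
  - by [].
exists (f \o pi); split; first exact: inj_comp.
- move=> i e eB; have [c cE|ni] := pickP [pred c | (w' c).1 == i]; last first.
    have -> : [set (f \o pi) (i, x) | x in e] = [set f (i, x) | x in e].
      by apply: eq_imset => x; rewrite /pi /=; case: pickP => // c; rewrite [_ == _]ni.
    by apply: fB => //; have := ni q; rewrite /= /w' eqxx /= eq_sym => ->.
  have piE p : pi (i, p) = sh c (w' p).
    rewrite /pi /=; case: pickP => [c' /eqP cE'|/(_ c)]; last by rewrite [_ == _]cE.
    by have /ji -> : (w' c').1 = (w' c).1 by rewrite cE' (eqP cE).
  have [qe|qe] := boolP (q \in e).
    move: (h4 c e eB qe); congr (_ \in H); rewrite -{2}(setD1K qe) imsetU1; congr (_ |: _).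
      by rewrite /= piE /w' eqxx /sh /= adz.
    by apply: eq_in_imset => p; rewrite !inE /= piE /w' => /andP[/negbTE ->].
  move: (h3 c e eB); congr (_ \in H); apply: eq_in_imset => p pe; rewrite /= piE /w'.
  by case: eqP => // E; rewrite -E pe in qe.
- apply/eqP; rewrite eq_sym eqEcard !card_imset ?leqnn ?andbT //; last exact: inj_comp.
  by apply/subsetP => v /imsetP[a _ ->]; apply: imset_f.
Qed.

End Exchange.

(* Adding edges one at a time until the graph is complete, it suffices to repair a perfect tiling in which
   a single copy uses a missing edge. *)
Lemma perfect_tiling (T V : finType) (B : {set {set T}}) (W : {set V}) k K mu nu :
  (forall e, e \in B -> #|e| = k.+1) -> #|W| = K * #|T| ->
  #|T| ^ 3 * (K * #|T|) ^ k + #|T| * #|B| * mu + k.+1 * #|B| * (K * #|T|) * nu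
    < (K * #|T|) ^ k.+1 ->
  forall H : {set {set V}},
  ntup k.+1 (fun y => [set x in y] \notin H) <= mu -> (forall v, v \in W -> mdg k H v <= nu) ->
  tiled B H K W.
Proof.
(* Induction on the number of vertex sets, of any size, absent from [H]; when none is absent, any
   bijection onto [W] is a tiling. *)
move=> Br cW hN H; have [n] := ubnP #|~: H|.
elim: n H => // n IH H; rewrite ltnS => cH hmu hnu.
have [/eqP E|/set0Pn[e eH]] := boolP (~: H == set0).
  have HT e : e \in H by rewrite -[H]setCK E setC0 inE.
  have cc : #|{: 'I_K * T}| = #|W| by rewrite card_prod card_ord cW.
  pose g (a : 'I_K * T) := enum_val (cast_ord cc (enum_rank a)).
  have gi : injective g by move=> a b /enum_val_inj/cast_ord_inj/enum_rank_inj.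
  exists g; split=> //; apply/eqP; rewrite eq_sym eqEcard card_imset // cardsT cc leqnn andbT.
  by apply/subsetP => v /imsetP[a _ ->]; apply: enum_valP.
have eH' : e \notin H by rewrite inE in eH.
have HS : {subset H <= e |: H} by move=> x xH; rewrite inE xH orbT.
have [|||f [fi fB WE]] := IH (e |: H).
- by apply: leq_trans cH; rewrite setCU; apply/proper_card/properP; split;
    [apply: subsetIr|exists e => //; rewrite !inE eqxx].
- by apply: leq_trans hmu; apply: leq_ntup => y _; apply: contra; apply: HS.
- move=> v vW; apply: leq_trans (hnu v vW); apply: leq_ntup => y _; apply: contra; exact: HS.
have [/forallP h|] := boolP [forall i, [forall e' in B, [set f (i, x) | x in e'] \in H]].
  by exists f; split=> // i e' e'B; have /forall_inP := h i; apply.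
rewrite negb_forall => /existsP[i0]; rewrite negb_forall => /existsP[e'].
rewrite negb_imply => /andP[e'B bad].
have eE : [set f (i0, x) | x in e'] = e.
  by have := fB i0 e' e'B; rewrite inE (negbTE bad) orbF inE => /eqP.
rewrite WE; apply: (@exchange _ _ _ _ k _ _ i0 mu nu) => //.
(* Another copy using [e] would share a vertex with copy [i0], as [e] is nonempty. *)
- move=> i ii0 e'' e''B; have := fB i e'' e''B; rewrite inE => /orP[|//]; rewrite inE -eE => /eqP E.
  have [x xe] : exists x, x \in e'' by apply/set0Pn; rewrite -card_gt0 (Br _ e''B).
  have : f (i, x) \in [set f (i0, x) | x in e'] by rewrite -E; apply/imsetP; exists x.
  by move=> /imsetP[y _ /fi[E' _]]; rewrite E' eqxx in ii0.
- by move=> x; apply: hnu; rewrite WE imset_f.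
- by apply/set0Pn; exists e'.
Qed.

(** * Using up the vertices of small degree *)

Lemma set_between (V : finType) (A C : {set V}) m : A \subset C -> #|A| <= m <= #|C| ->
  exists Z : {set V}, [/\ A \subset Z, Z \subset C & #|Z| = m].
Proof.
move=> AC; elim: m => [|m IH] /andP[Am mC].
  by exists A; split=> //; apply/eqP; rewrite -leqn0.
have [Am'|/eqP ->] : #|A| <= m \/ m.+1 == #|A| by lia.
  have [|Z [AZ ZC cZ]] := IH; first by rewrite Am' ltnW.
  have /properP[_ [x xC xZ]] : Z \proper C by rewrite properEcard ZC cZ.
  exists (x |: Z); rewrite cardsU1 xZ cZ add1n; split=> //.
    by apply: subset_trans AZ _; apply: subsetUr.
  by rewrite subUset sub1set xC.
by exists A.
Qed.

(** Pascal's rule iterated: each of the [y] steps adds at least ['C(x, k)]. *)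
Lemma bin_addl_ge x y k : 'C(x, k.+1) + y * 'C(x, k) <= 'C(x + y, k.+1).
Proof.
elim: y => [|y IH]; first by rewrite addn0 mul0n addn0.
rewrite addnS binS mulSn addnCA addnC leq_add // leq_bin2l //; exact: leq_addr.
Qed.

Lemma card_edges_disjoint (V : finType) k (H : {set {set V}}) (A : {set V}) : uniform k H ->
  #|H| <= #|[set e in H | ~~ [disjoint e & A]]| + 'C(#|V| - #|A|, k).
Proof.
move=> /forall_inP uH; rewrite -(cardsC A) addKn -cards_draws.
apply: leq_trans (leq_card_setU _ _); apply/subset_leq_card/subsetP => e eH.
rewrite !inE eH uH //= andbT -disjoints_subset.
by case: [disjoint _ & _].
Qed.

Lemma uniform_sub (V : finType) k (G H : {set {set V}}) : G \subset H -> uniform k H -> uniform k G.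
Proof. by move=> /subsetP GH /forall_inP uH; apply/forall_inP => e /GH /uH. Qed.

Lemma ex_star_contains (U : finType) r m n (F : {set {set U}}) (G : {set {set 'I_n}}) (V1 : {set 'I_n}) :
  uniform r G -> #|V1| = m -> (forall e, e \in G -> ~~ [disjoint e & V1]) ->
  ex_star r m n F < #|G| -> contains F G.
Proof.
move=> uG cV GV; apply: contraTT => nF; rewrite -leqNgt.
apply: (@leq_bigmax_cond _ _ (fun G : {set {set 'I_n}} => #|G|)).
rewrite uG nF andbT; apply/existsP; exists V1; rewrite cV eqxx; apply/forall_inP => e /GV.
by case/pred0Pn => v /andP[/= ve vV]; apply/exists_inP; exists v.
Qed.

Section Phases.
Variables (T V : finType) (B : {set {set T}}).
Implicit Types (H G : {set {set V}}) (A U Y : {set V}).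

(** Each new copy covers a vertex of [L] still uncovered, so at most [#|L|] are added; [M] bounds
    the vertices ever in use, which keeps the covering hypothesis applicable. *)
Lemma greedy_cover H M (L : {set V}) :
  (forall U u, #|U| <= M -> u \in L -> u \notin U -> exists f : T -> V,
    [/\ injective f, forall e, e \in B -> f @: e \in H, u \in f @: setT & [disjoint f @: setT & U]]) ->
  forall c U, tiled B H c U -> (c + #|L|) * #|T| <= M ->
  exists c' U', [/\ tiled B H c' U', U \subset U', L \subset U' & c' <= c + #|L|].
Proof.
move=> hcov c U tU hM.
suff [c' [U' [h1 h2 h3 h4]]] : exists c' U',
    [/\ tiled B H c' U', U \subset U', L \subset U' & c' <= c + #|L :\: U|].
  by exists c', U'; split=> //; apply: leq_trans h4 _; rewrite leq_add2l subset_leq_card ?subsetDl.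
have {hM} : (c + #|L :\: U|) * #|T| <= M.
  by apply: leq_trans hM; rewrite leq_mul2r leq_add2l subset_leq_card ?subsetDl ?orbT.
have [d] := ubnP #|L :\: U|; elim: d c U tU => // d IH c U tU; rewrite ltnS => cd hM.
have [LU|/subsetPn[u uL uU]] := boolP (L \subset U).
  by exists c, U; split=> //; apply: leq_addr.
have [|f [fi fB uf dis]] := hcov U u _ uL uU.
  by rewrite (tiled_card tU); apply: leq_trans hM; rewrite leq_mul2r leq_addr orbT.
have t' : tiled B H (c + 1) (U :|: f @: setT).
  by apply: tiledU tU (tiled1 fi fB) _; rewrite disjoint_sym.
have lt : #|L :\: (U :|: f @: setT)| < #|L :\: U|.
  apply/proper_card/properP; split; first by apply: setDS; apply: subsetUl.
  by exists u; rewrite !inE ?uL ?uU ?uf ?orbT.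
have [||c' [U' [h1 h2 h3 h4]]] := IH _ _ t'; first exact: leq_trans cd.
  by apply: leq_trans hM; rewrite leq_mul2r; apply/orP; right; lia.
exists c', U'; split=> //; first exact: subset_trans (subsetUl _ _) h2.
by apply: leq_trans h4 _; lia.
Qed.

(* Only the vertices lying on edges of B matter; the isolated ones can be moved off Y. *)
Lemma move_isolated G Y (f : T -> V) : injective f -> (forall e, e \in B -> f @: e \in G) ->
  (forall e, e \in G -> [disjoint e & Y]) -> #|Y| + 2 * #|T| <= #|V| ->
  exists g : T -> V, [/\ injective g, forall e, e \in B -> g @: e \in G & [disjoint g @: setT & Y]].
Proof.
move=> fi fB GY hn; pose C := ~: (Y :|: f @: setT).
have cC : #|T| <= #|C|.
  have := cardsC (Y :|: f @: setT); rewrite -/C.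
  have : #|Y :|: f @: setT| <= #|Y| + #|T| by rewrite -[#|T|]cardsT -(card_imset _ fi) leq_card_setU.
  lia.
pose h x := enum_val (widen_ord cC (enum_rank x)).
have hC x : h x \in C by apply: enum_valP.
have hi : injective h.
  by move=> x y /enum_val_inj/(congr1 val)/= /val_inj/enum_rank_inj.
have hf x y : h x <> f y by move=> E; have := hC x; rewrite !inE E imset_f ?inE // orbT.
pose g x := if x \in cover B then f x else h x.
exists g; split.
- move=> x y; rewrite /g; case: ifP => _; case: ifP => _.
  + exact: fi.
  + by move=> /esym /hf.
  + by move=> /hf.
  + exact: hi.
- move=> e eB; have -> : g @: e = f @: e; last exact: fB.
  apply: eq_in_imset => x xe; rewrite /g ifT //; apply/bigcupP; by exists e.
- apply/pred0P => v /=; apply/negbTE/negP => /andP[/imsetP[x _ ->]]; rewrite /g.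
  case: ifP => [/bigcupP[e eB xe]|_] gY; last by have := hC x; rewrite !inE gY.
  have /pred0P/(_ (f x)) := GY _ (fB _ eB).
  by rewrite /= gY andbT => /negP; apply; apply: imset_f.
Qed.

Variables (H : {set {set V}}) (k m X D : nat) (A : {set V}).
Hypothesis uH : uniform k.+1 H.
Hypothesis B0 : B != set0.
Hypothesis T0 : 0 < #|T|.
Hypothesis sm : #|T| <= m <= #|V|.
Hypothesis hX : forall G (V1 : {set V}), uniform k.+1 G -> #|V1| = m ->
  (forall e, e \in G -> ~~ [disjoint e & V1]) -> X < #|G| -> contains (copies #|T| B) G.
Hypothesis hH : 'C(#|V| - m + #|T| - 1, k.+1) + X < #|H|.

(** Enlarge [A] to an [m]-set [V1]. At most ['C(#|V| - m, k.+1)] edges avoid it, so more than [X],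
    which stands for the star extremal number, meet it. Each of the resulting [#|T|] copies uses a
    vertex of [V1]. *)
Lemma star_few : #|A| <= m ->
  exists U, tiled B H #|T| U /\ #|A :\: U| <= m - #|T|.
Proof.
move=> Am; have /andP[sm1 mn] := sm.
have [V1 [AV _ cV]] : exists V1 : {set V}, [/\ A \subset V1, V1 \subset setT & #|V1| = m].
  by apply: set_between; rewrite ?subsetT // Am cardsT.
pose G := [set e in H | ~~ [disjoint e & V1]].
have GH : G \subset H by apply/subsetP => e; rewrite inE => /andP[].
have GV e : e \in G -> ~~ [disjoint e & V1] by rewrite inE => /andP[].
have cG : X < #|G|.
  have := card_edges_disjoint V1 uH; rewrite -/G cV.
  have : 'C(#|V| - m, k.+1) <= 'C(#|V| - m + #|T| - 1, k.+1) by apply: leq_bin2l; lia.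
  lia.
have [U tU] := contains_tiled (hX (uniform_sub GH uH) cV GV cG).
exists U; split; first exact: tiled_sub tU.
have sU := tiled_star B0 GV tU; have := cardsID U V1; rewrite setIC cV.
have : #|A :\: U| <= #|V1 :\: U| by apply/subset_leq_card/setSD.
lia.
Qed.

Hypothesis k0 : 0 < k.
Hypothesis dA : forall v, v \in A -> D * dg k H v <= #|V| ^ k.
Hypothesis Dk : D * k * #|A| <= #|V|.
Hypothesis Ds : 4 * #|T| <= D.
Hypothesis An : #|A| * #|T| + 2 * #|T| <= #|V|.
Hypothesis hff : #|V| ^ k <= 2 * (#|V| - #|A|) ^_ k.

(** Choose [a] copies greedily in the graph [G] of edges meeting [A]. If this stops with vertex set
    [Y] used, every edge of [G] meets [Y], or avoids [Y] and meets an [m]-set [V1] or the at most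
    [a - s] vertices of [A] outside both. The [V1] kind number at most [X], and small degrees in [G]
    make the others too few for [hG]. *)
Lemma star_many : m < #|A| ->
  exists c U, [/\ tiled B H c U, c <= #|A| & #|A :\: U| <= m - #|T|].
Proof.
move=> mA; have /andP[sm1 mn] := sm; set s := #|T| in sm1 *; set n := #|V| in mn *.
pose a := #|A| - m + s.
have An' : #|A| <= n by apply: max_card.
have s0 : 0 < s by [].
pose G := [set e in H | ~~ [disjoint e & A]].
have GH : G \subset H by apply/subsetP => e; rewrite inE => /andP[].
have GA e : e \in G -> ~~ [disjoint e & A] by rewrite inE => /andP[].
have uG := uniform_sub GH uH.
have hG : X + (a - 1) * 'C(n - #|A|, k) < #|G|.
  have := card_edges_disjoint A uH; rewrite -/G -/n.
  have := bin_addl_ge (n - #|A|) (a - 1) k.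
  have -> : n - #|A| + (a - 1) = n - m + s - 1 by rewrite /a; lia.
  by move: hH; rewrite -/s -/n; set c1 := 'C(_, _); set c2 := 'C(_, k.+1); set c3 := _ * _; lia.
(* Vertices of [A] have small degree by hypothesis; an edge of [G] at any other vertex must contain
   one of the few vertices of [A]. *)
have dG v : D * dg k G v <= n ^ k.
  have [vA|vA] := boolP (v \in A).
    apply: leq_trans (dA vA); rewrite leq_mul2l; apply/orP; right.
    by apply: leq_ntup => y _; apply: (subsetP GH).
  have : dg k G v <= k * #|A| * n ^ k.-1.
    apply: leq_trans (ntup_has k A); apply: leq_ntup => y _ /GA /pred0Pn[x /andP[]] /=.
    rewrite !inE => /orP[/eqP -> vA'|xy xA]; first by rewrite vA' in vA.
    by apply/hasP; exists x.
  move=> h; apply: (@leq_trans (D * (k * #|A| * n ^ k.-1))); first by rewrite leq_mul2l h orbT.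
  rewrite !mulnA -[in leqRHS](prednK k0) expnS leq_mul2r; apply/orP; right; exact: Dk.
have sum_dG G1 (Y : {set V}) : G1 \subset G ->
    D * (k`! * #|[set e in G1 | ~~ [disjoint e & Y]]|) <= #|Y| * n ^ k.
  move=> G1G; apply: (@leq_trans (D * \sum_(y in Y) dg k G1 y)).
    by rewrite leq_mul2l meet_dg ?orbT //; apply: uniform_sub uG.
  rewrite big_distrr -sum_nat_const /=; apply: leq_sum => y _; apply: leq_trans (dG y).
  rewrite leq_mul2l; apply/orP; right; apply: leq_ntup => z _; exact: (subsetP G1G).
suff [U tU] : exists U, tiled B G a U.
  have sU := tiled_star B0 GA tU; exists a, U; split; first exact: tiled_sub tU.
    by rewrite /a; lia.
  by have := cardsID U A; rewrite setIC; rewrite /a in sU *; lia.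
have: a <= a by [].
elim: {-2}a => [_|b IH ba]; first by exists set0; apply: tiled0.
have [Y tY] := IH (ltnW ba); have cY := tiled_card tY.
have bA : b < #|A| by rewrite /a in ba; lia.
pose G' := [set e in G | [disjoint e & Y]].
have G'G : G' \subset G by apply/subsetP => e; rewrite inE => /andP[].
have [V1 [cV hV1]] : exists V1 : {set V}, #|V1| = m /\ #|(A :\: Y) :\: V1| <= #|A| - m.
  have cA' : #|A :\: Y| <= #|A| by apply/subset_leq_card/subsetDl.
  have [le|lt] := leqP #|A :\: Y| m.
    have [|Z [AZ _ cZ]] := @set_between _ _ setT m (subsetT (A :\: Y)); first by rewrite le cardsT.
    by exists Z; split=> //; rewrite (_ : _ :\: Z = set0) ?cards0 //; apply/eqP; rewrite setD_eq0.
  have [|Z [_ ZA cZ]] := @set_between _ _ (A :\: Y) m (sub0set _); first by rewrite cards0; apply: ltnW.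
  exists Z; split=> //; have := cardsID Z (A :\: Y); rewrite (setIidPr ZA) cZ; lia.
pose G'' := [set e in G' | ~~ [disjoint e & V1]].
have G''G' : G'' \subset G' by apply/subsetP => e; rewrite inE => /andP[].
have G''G := subset_trans G''G' G'G.
have [few|many] := leqP #|G''| X; last first.
  have GV e : e \in G'' -> ~~ [disjoint e & V1] by rewrite inE => /andP[].
  have [Z tZ] := contains_tiled (hX (uniform_sub G''G uG) cV GV many).
  (* A single copy is kept; its edges avoid [Y], so only isolated vertices have to be moved. *)
  have [Z' [f [fi fB _]]] := tiled_leq T0 tZ.
  have [||||g [gi gB gY]] := @move_isolated G'' Y (fun x => f (ord0, x)).
  - by move=> x y /fi[].
  - by move=> e; apply: fB.
  - by move=> e /(subsetP G''G'); rewrite inE => /andP[].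
  - apply: leq_trans An; rewrite leq_add2r cY leq_mul2r; apply/orP; right; exact: ltnW.
  exists (Y :|: g @: setT); rewrite -addn1; apply: tiledU tY _ _; last by rewrite disjoint_sym.
  by apply: tiled1 => // e /gB /(subsetP G''G).
have cG : #|G| <= #|[set e in G | ~~ [disjoint e & Y]]| +
    (X + #|[set e in G' | ~~ [disjoint e & (A :\: Y) :\: V1]]|).
  have : G \subset [set e in G | ~~ [disjoint e & Y]] :|:
     (G'' :|: [set e in G' | ~~ [disjoint e & (A :\: Y) :\: V1]]).
    apply/subsetP => e eG; rewrite !in_setU.
    have [dY|dY] := boolP [disjoint e & Y]; last by apply/orP; left; rewrite inE eG.
    have eG' : e \in G' by rewrite inE eG.
    apply/orP; right; have [dV|dV] := boolP [disjoint e & V1]; last by apply/orP; left; rewrite inE eG'.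
    apply/orP; right; rewrite inE eG' /=.
    have /pred0Pn[x /andP[/= xe xA]] := GA _ eG; apply/pred0Pn; exists x; rewrite /= xe !inE xA.
    by rewrite (disjointFr dV xe) (disjointFr dY xe).
  move/subset_leq_card => h; apply: leq_trans h _; apply: leq_trans (leq_card_setU _ _) _.
  rewrite leq_add2l; apply: leq_trans (leq_card_setU _ _) _; rewrite leq_add2r //.
have h1 := sum_dG G Y (subxx _); have h2 := sum_dG G' ((A :\: Y) :\: V1) G'G.
exfalso.
move: h1 h2 cG hG; set g1 := #|[set e in G | _]|; set g2 := #|[set e in G' | _]|.
rewrite cY -/s => h1 h2 cG hG.
have h2' : D * (k`! * g2) <= (a - s) * n ^ k.
  by apply: leq_trans h2 _; rewrite leq_mul2r /a addnK hV1 orbT.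
have h3 : X + (a - 1) * 'C(n - #|A|, k) < g1 + (X + g2) by apply: leq_trans hG cG.
have {}h3 : (a - 1) * 'C(n - #|A|, k) < g1 + g2 by move: h3; set z := _ * _; lia.
have F0 : 0 < k`! by apply: fact_gt0.
have D0 : 0 < D by apply: leq_trans Ds; rewrite muln_gt0.
have h4 : D * (a - 1) * (n - #|A|) ^_ k < (b * s + (a - s)) * n ^ k.
  apply: (@leq_trans (D * (k`! * (g1 + g2)))).
    rewrite -bin_ffact -mulnA ltn_pmul2l // [_ * k`!]mulnC mulnCA ltn_pmul2l //.
  by rewrite !mulnDr mulnDl leq_add.
(* Both summands are at most [s * (a - 1)]; with the factor 2 from [hff] this makes the [4 * s] that
   [Ds] bounds by [D]. *)
have h5 : b * s + (a - s) <= 2 * s * (a - 1).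
  have b1 : b <= a - 1 by rewrite subn1 -ltnS (ltn_predK ba).
  apply: leq_trans (leq_add (leq_mul b1 (leqnn s)) (leq_trans (leq_sub2l a s0) (leq_pmulr _ s0))) _.
  by rewrite addnn -mul2n [_ * s]mulnC mulnA.
have h6 : (b * s + (a - s)) * n ^ k <= 2 * s * (a - 1) * (2 * (n - #|A|) ^_ k) by apply: leq_mul.
have h7 : 2 * s * (a - 1) * (2 * (n - #|A|) ^_ k) = (4 * s) * (a - 1) * (n - #|A|) ^_ k.
  by rewrite mulnA -[_ * 2]mulnC !mulnA.
have := leq_trans h4 h6; rewrite h7 ltnNge => /negP; apply.
by rewrite !leq_mul2r Ds !orbT.
Qed.

End Phases.

(** * Numerical estimates *)

(* x bounds, up to constants, the number of vertices used by all the copies chosen before the perfect tiling. *)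
Section Arith.
Variables r s P m n : nat.
Hypotheses (r2 : 2 <= r) (rs : r <= s) (sm : s <= m) (P1 : 1 <= P).
Hypothesis hn : 64 * (r ^ 4 * s * P * m) <= n.

Let x := r * r * P * s * m.

(** [hn] amounts to [64 * r ^ 2 * x <= n]; later quantities are compared with [x], [r * x] or
    [r ^ 2 * x], each factor [r] being worth at least 2. *)
Lemma used_bounds : [/\ 64 * (r * (r * x)) <= n, 2 * x <= r * x, 2 * (r * x) <= r * (r * x) &
  [/\ r * (r * r * P * m) <= x, r * (r * r * P) <= x & r * m * s <= x]].
Proof.
split; last split.
- by apply: leq_trans hn; rewrite /x; lia.
- by rewrite leq_mul2r r2 orbT.
- by rewrite leq_mul2r r2 orbT.
- rewrite /x -mulnA mulnC -!mulnA !leq_mul2l [m * r]mulnC leq_mul2r rs !orbT //.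
- rewrite /x mulnC -!mulnA !leq_mul2l; apply/orP; right; apply/orP; right; apply/orP; right.
  by apply: leq_trans rs _; rewrite leq_pmulr //; lia.
- rewrite /x; have rP : 1 <= r * P by rewrite muln_gt0 P1 andbT; lia.
  have -> : r * r * P * s * m = (r * P) * (r * m * s) by lia.
  by rewrite leq_pmull.
Qed.

Lemma used_pos : [/\ 0 < r * m * s, 1 <= m & r <= r * m * s].
Proof.
have m1 : 1 <= m by lia.
have s1 : 1 <= s by lia.
have r1 : 1 <= r by lia.
split; rewrite ?muln_gt0 ?m1 ?s1 ?r1 // -mulnA leq_pmulr // muln_gt0 m1 //.
Qed.

Lemma arith_Dk A : A <= 2 * (r * m) -> 8 * (r * r * P) * r.-1 * A <= n.
Proof.
have [h1 h2 h3 [h4 h5 h6]] := used_bounds.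
move=> hA; apply: (@leq_trans (8 * (r * r * P) * r * (2 * (r * m)))).
  by apply: leq_mul => //; rewrite leq_mul2l leq_pred orbT.
have -> : 8 * (r * r * P) * r * (2 * (r * m)) = 16 * (r * (r * (r * r * P * m))) by lia.
have h7 : r * (r * (r * r * P * m)) <= r * x by rewrite leq_mul2l h4 orbT.
by lia.
Qed.

Lemma arith_Ds : s <= r * P -> 4 * s <= 8 * (r * r * P).
Proof.
move=> h; have : r * P <= r * r * P by rewrite -mulnA leq_pmull //; lia.
by lia.
Qed.

Lemma arith_An A : A <= 2 * (r * m) -> A * s + 2 * s <= n.
Proof.
have [h1 h2 h3 [h4 h5 h6]] := used_bounds; have [q1 q2 q3] := used_pos.
move=> hA; have : A * s <= 2 * (r * m) * s by rewrite leq_mul2r hA orbT.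
have : s <= r * m * s by rewrite leq_pmull // muln_gt0; lia.
have -> : 2 * (r * m) * s = 2 * (r * m * s) by lia.
by lia.
Qed.

Lemma arith_q A : A <= 2 * (r * m) -> 2 * (r.-1 * (A + r.-2)) <= n.
Proof.
have [h1 h2 h3 [h4 h5 h6]] := used_bounds; have [q1 q2 q3] := used_pos.
move=> hA; have h7 : A + r.-2 <= 3 * (r * m * s).
  have h8 : r * m <= r * m * s by rewrite leq_pmulr; lia.
  by lia.
have : r.-1 * (A + r.-2) <= r * (3 * x) by apply: leq_mul; lia.
by rewrite mulnCA; lia.
Qed.

Lemma arith_cover1 U : U <= 4 * (r * m) * s ->
  32 * (r * r * P) * (r * m + r * U.+1) <= 3 * n.
Proof.
have [h1 h2 h3 [h4 h5 h6]] := used_bounds; have [q1 q2 q3] := used_pos.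
move=> hU; apply: (@leq_trans (32 * (r * r * P) * (r * m + r * (4 * (r * m) * s).+1))).
  by rewrite leq_mul2l; apply/orP; right; rewrite leq_add2l leq_mul2l; apply/orP; right.
have -> : 32 * (r * r * P) * (r * m + r * (4 * (r * m) * s).+1) =
  32 * (r * (r * r * P * m)) + 32 * (r * (r * r * P)) + 128 * (r * (r * x)) by rewrite /x; lia.
by lia.
Qed.

Lemma arith_cover2 U : U <= (4 * (r * m) + 4 * (r * r * P * m)) * s ->
  32 * (r * m + r * U.+1) <= 3 * n.
Proof.
have [h1 h2 h3 [h4 h5 h6]] := used_bounds; have [q1 q2 q3] := used_pos.
move=> hU; apply: (@leq_trans (32 * (r * m + r * ((4 * (r * m) + 4 * (r * r * P * m)) * s).+1))).
  by rewrite leq_mul2l; apply/orP; right; rewrite leq_add2l leq_mul2l; apply/orP; right.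
have -> : 32 * (r * m + r * ((4 * (r * m) + 4 * (r * r * P * m)) * s).+1) =
  32 * (r * m) + 32 * r + 128 * (r * (r * m * s)) + 128 * (r * x) by rewrite /x; lia.
have h7 : r * (r * m * s) <= r * x by rewrite leq_mul2l h6 orbT.
have h8 : r * m <= r * m * s by rewrite leq_pmulr; lia.
by lia.
Qed.

Lemma arith_rest c : c <= 4 * (r * m) + 4 * (r * r * P * m) -> 16 * (r * (c * s + m)) <= 2 * n /\ c * s + m <= n.
Proof.
have [h1 h2 h3 [h4 h5 h6]] := used_bounds; have [q1 q2 q3] := used_pos.
move=> hc; have h7 : c * s <= (4 * (r * m) + 4 * (r * r * P * m)) * s by rewrite leq_mul2r hc orbT.
have h8 : (4 * (r * m) + 4 * (r * r * P * m)) * s = 4 * (r * m * s) + 4 * x by rewrite /x; lia.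
have h9 : m <= r * m * s by rewrite mulnC mulnA leq_pmull // muln_gt0; lia.
have h10 : c * s + m <= 9 * x by lia.
have : r * (c * s + m) <= r * (9 * x) by rewrite leq_mul2l h10 orbT.
by rewrite mulnCA; lia.
Qed.

Lemma arith_mu : 256 * (s * P * (r * m)) <= n.
Proof.
have [h1 h2 h3 _] := used_bounds.
have h4 : s * P * (r * m) * 2 <= x.
  have -> : x = (s * P * (r * m)) * r by rewrite /x; lia.
  by rewrite leq_mul2l r2 orbT.
by lia.
Qed.

(** The hypothesis of [cover_vertex] with [q = 32 * (r * r * P)]. The degree bound makes the right
    side at least [4 * n * Nk]: one part is the required density, three absorb the losses. *)
Lemma arith_cover1_density U Nk miss d : U <= 4 * (r * m) * s -> miss <= r * m * Nk ->
  Nk <= 8 * (r * r * P) * d ->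
  n * Nk + 32 * (r * r * P) * (miss + r * U.+1 * Nk) <= 32 * (r * r * P) * (n * d).
Proof.
move=> hU hmiss hd; apply: (@leq_trans (4 * n * Nk)); last first.
  have -> : 32 * (r * r * P) * (n * d) = 4 * n * (8 * (r * r * P) * d) by lia.
  by rewrite leq_mul2l hd orbT.
have : 32 * (r * r * P) * (miss + r * U.+1 * Nk) <= 3 * n * Nk.
  apply: (@leq_trans (32 * (r * r * P) * (r * m + r * U.+1) * Nk)).
    by rewrite -[leqRHS]mulnA mulnDl leq_mul2l leq_add2r hmiss orbT.
  by rewrite leq_mul2r arith_cover1 ?orbT.
by lia.
Qed.

(** Same [q], but a degree of at least [Nk / 2] makes the right side at least
    [16 * (r * r * P) * n * Nk], which leaves room for a larger [U]. *)
Lemma arith_cover2_density U Nk miss d : U <= (4 * (r * m) + 4 * (r * r * P * m)) * s ->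
  miss <= r * m * Nk -> Nk <= 2 * d ->
  n * Nk + 32 * (r * r * P) * (miss + r * U.+1 * Nk) <= 32 * (r * r * P) * (n * d).
Proof.
move=> hU hmiss hd; set w := r * r * P.
have w1 : 1 <= w by rewrite !muln_gt0 P1; lia.
apply: (@leq_trans (w * (16 * (n * Nk)))); last first.
  have -> : 32 * w * (n * d) = w * (16 * (n * (2 * d))) by lia.
  by rewrite !leq_mul2l hd !orbT.
have h1 : n * Nk <= w * (n * Nk) by rewrite leq_pmull.
have h2 : 32 * w * (miss + r * U.+1 * Nk) <= w * (3 * (n * Nk)).
  have -> : 32 * w * (miss + r * U.+1 * Nk) = w * (32 * (miss + r * U.+1 * Nk)) by lia.
  rewrite leq_mul2l; apply/orP; right.
  apply: (@leq_trans (32 * (r * m + r * U.+1) * Nk)).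
    by rewrite -[leqRHS]mulnA mulnDl leq_mul2l leq_add2r hmiss orbT.
  by rewrite mulnA leq_mul2r (arith_cover2 hU) orbT.
apply: leq_trans (leq_add h1 h2) _; rewrite -mulnDr leq_mul2l; apply/orP; right; lia.
Qed.

(** In units of [n ^ r], the right side is at least 7/8 by Bernoulli and the left at most 1/64 +
    1/256 + 1/4. *)
Lemma arith_perfect N b nu k : k.+1 = r -> b <= P -> N <= n -> 8 * (r * (n - N)) <= n -> 64 * s ^ 3 <= n ->
  4 * (r * P) * nu <= n ^ k ->
  s ^ 3 * N ^ k + s * b * (r * m * n ^ k) + k.+1 * b * N * nu < N ^ k.+1.
Proof.
move=> kr bP Nn hq hs hnu.
have n0 : 0 < n by have := arith_mu; lia.
have := expn_sub_bernoulli n (n - N) k.+1; rewrite subKn //= kr.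
set Nk := n ^ k in hnu *; set Mr := N ^ r => hb.
have Nk0 : 0 < Nk by rewrite expn_gt0 n0.
have e1 : n ^ r = n * Nk by rewrite -kr expnS.
have e2 : 8 * (r * (n - N) * Nk) <= n * Nk by rewrite mulnA leq_mul2r hq orbT.
have e3 : 64 * (s ^ 3 * N ^ k) <= n * Nk.
  rewrite mulnA; apply: leq_mul => //; rewrite /Nk; case: (k) => // k'; by rewrite leq_exp2r.
have e4 : 256 * (s * b * (r * m * Nk)) <= n * Nk.
  apply: (@leq_trans (256 * (s * P * (r * m)) * Nk)); last by rewrite leq_mul2r arith_mu orbT.
  by rewrite -!mulnA leq_mul2l leq_mul2l leq_mul // !orbT.
have e5 : 4 * (r * b * N * nu) <= n * Nk.
  apply: (@leq_trans (n * (4 * (r * P) * nu))); last by rewrite leq_mul2l hnu orbT.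
  have -> : 4 * (r * b * N * nu) = N * (4 * (r * b) * nu) by lia.
  by apply: leq_mul => //; rewrite leq_mul2r !leq_mul2l bP !orbT.
have e6 : 0 < n * Nk by rewrite muln_gt0 n0.
rewrite e1 in hb; lia.
Qed.

End Arith.

(** * Assembling the tiling *)

(** As [j - 1 >= k], the falling factorial is at least [(#|V| - m) ^ k.+1], and Bernoulli bounds
    what is missing. *)
Lemma miss_upper (V : finType) (H : {set {set V}}) k m j : uniform k.+1 H -> m <= #|V| -> k < j ->
  'C(#|V| - m + j - 1, k.+1) <= #|H| ->
  ntup k.+1 (fun y => [set x in y] \notin H) <= k.+1 * m * #|V| ^ k.
Proof.
move=> uH mn kj hH.
have E : k.+1`! * #|H| + ntup k.+1 (fun y => [set x in y] \notin H) = #|V| ^ k.+1.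
  by rewrite -ntup_edges //; apply: ntupC.
have := expn_sub_bernoulli #|V| m k.+1; rewrite -{}E /=.
have h1 : (#|V| - m) ^ k.+1 <= k.+1`! * #|H|.
  apply: (@leq_trans (k.+1`! * 'C(#|V| - m + j - 1, k.+1))); last by rewrite leq_mul2l hH orbT.
  rewrite mulnC bin_ffact; apply: leq_trans (ffact_ge _ _); rewrite leq_exp2r //=; lia.
set x1 := ntup _ _; move: h1; set x2 := _ * #|H|; set x3 := _ * _ ^ k; set x4 := _ ^ k.+1; lia.
Qed.

(** Markov's inequality: the missing degrees sum to the number of tuples that span no edge. *)
Lemma card_large_mdg (V : finType) (H : {set {set V}}) k c M (L : {set V}) : 0 < #|V| ->
  (forall v, v \in L -> #|V| ^ k <= c * mdg k H v) ->
  ntup k.+1 (fun y => [set x in y] \notin H) <= M * #|V| ^ k -> #|L| <= c * M.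
Proof.
move=> V0 hL hM; have p : 0 < #|V| ^ k by rewrite expn_gt0 V0.
rewrite -(leq_pmul2r p) -mulnA; apply: leq_trans (leq_mul (leqnn c) hM).
rewrite -sum_mdg big_distrr -sum_nat_const /= big_mkcond /=; apply: leq_sum => v _.
by case: ifP => // /hL.
Qed.

Lemma tiling_exists (T : finType) (B : {set {set T}}) k (part : T -> 'I_k.+1) (x0 : T) P :
  0 < k -> (forall e, e \in B -> forall i, #|[set x in e | part x == i]| = 1) -> part x0 = ord0 ->
  (forall e, e \in B -> #|e| = k.+1) -> B != set0 -> 0 < P -> #|B| <= P -> #|T| <= k.+1 * P ->
  exists n0, forall (V : finType) (H : {set {set V}}) m t X, n0 <= #|V| ->
  uniform k.+1 H -> #|V| = m + #|T| * t -> #|T| <= m -> 64 * (k.+1 ^ 4 * #|T| * P * m) <= #|V| ->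
  (forall G (V1 : {set V}), uniform k.+1 G -> #|V1| = m ->
    (forall e, e \in G -> ~~ [disjoint e & V1]) -> X < #|G| -> contains (copies #|T| B) G) ->
  'C(#|V| - m + #|T| - 1, k.+1) + X < #|H| ->
  contains (copies (t + 1) B) H.
Proof.
move=> k0 partB x0P Br B0 P0 BP sP.
have rs : k.+1 <= #|T| by have [e eB] := set0Pn _ B0; rewrite -(Br e eB) max_card.
have [n1 hcov] := cover_vertex (32 * (k.+1 * k.+1 * P)) partB x0P.
exists (n1 + 64 * #|T| ^ 3) => V H m t X nV uH nE sm hn hX hH.
set s := #|T| in rs sm hn hX hH nE nV sP *; set n := #|V| in nV nE hn hH *.
set r := k.+1 in uH hn hX hH rs hcov sP *.
have r2 : 2 <= r by [].
have s0 : 0 < s by apply: leq_trans rs.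
have n0 : 0 < n by move: nV; rewrite !expnS; nia.
have mn : m <= n by rewrite nE leq_addr.
have hmiss : ntup k.+1 (fun y => [set x in y] \notin H) <= r * m * n ^ k.
  by apply: (miss_upper uH mn rs); apply: leq_trans (ltnW hH); apply: leq_addr.
(* [A] holds the vertices of tiny degree, [L1] those of degree below half, [L2] those missing too
   much for the perfect tiling. They are treated in this order, the bound on used vertices growing
   as the degrees do. *)
pose D := 8 * (r * r * P).
pose A := [set v | D * dg k H v < n ^ k].
pose L1 := [set v | 2 * dg k H v < n ^ k].
pose L2 := [set v | n ^ k < 4 * (r * P) * mdg k H v].
have cL1 : #|L1| <= 2 * (r * m).
  apply: (card_large_mdg n0 _ hmiss) => v; rewrite inE => h.
  by move: h (dgK k H v); rewrite -/n; set y1 := dg k H v; set y2 := mdg k H v; set y3 := n ^ k; clear; lia.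
have cL2 : #|L2| <= 4 * (r * r * P * m).
  have -> : 4 * (r * r * P * m) = 4 * (r * P) * (r * m) by clear; lia.
  by apply: (card_large_mdg n0 _ hmiss) => v; rewrite inE => /ltnW.
have AL1 : A \subset L1.
  apply/subsetP => v; rewrite !inE; apply: leq_ltn_trans; rewrite leq_mul2r; apply/orP; right.
  have : 1 <= r * r * P by rewrite !muln_gt0 P0.
  by rewrite /D; clear; lia.
have cA : #|A| <= 2 * (r * m) by apply: leq_trans cL1; apply: subset_leq_card.
have [c0 [U0 [tU0 hc0 AU0]]] : exists c0 U0,
    [/\ tiled B H c0 U0, c0 <= 2 * (r * m) & #|A :\: U0| <= m - s].
  have [Am|mA] := leqP #|A| m.
    have [|U [tU hU]] := star_few uH B0 s0 _ hX hH Am; first by rewrite -/s sm.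
    exists s, U; split=> //; apply: leq_trans sm _; rewrite mulnA leq_pmull //.
  have [||||||c [U [h1 h2 h3]]] := @star_many _ _ _ _ _ _ _ D A uH B0 s0 _ hX hH k0 _ _ _ _ _ mA.
  - by rewrite -/s sm.
  - by move=> v; rewrite inE => /ltnW.
  - exact: (arith_Dk r2 rs sm P0 hn cA).
  - exact: arith_Ds sP.
  - exact: (arith_An r2 rs sm P0 hn cA).
  - have := arith_q r2 rs sm P0 hn cA; rewrite -/n /= => hq.
    have := expn_sub_bernoulli n (#|A| + k.-1) k; have := ffact_ge (n - #|A|) k; rewrite subnDA.
    have : 2 * (k * (#|A| + k.-1) * n ^ k.-1) <= n ^ k.
      by rewrite mulnA -[in leqRHS](prednK k0) expnS leq_mul2r hq orbT.
    rewrite /n; set y1 := _ ^_ _; set y2 := _ ^ k; set y3 := _ * _ ^ k.-1; set y4 := _ ^ k; clear; lia.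
  by exists c, U; split=> //; apply: leq_trans h2 cA.
have covL (L : {set V}) (M : nat) : (forall (U : {set V}) u, #|U| <= M -> u \in L ->
      n * n ^ k + 32 * (r * r * P) * (ntup k.+1 (fun y => [set x in y] \notin H) + r * #|U|.+1 * n ^ k)
      <= 32 * (r * r * P) * (n * dg k H u)) ->
    forall c U, tiled B H c U -> (c + #|L|) * s <= M ->
    exists c' U', [/\ tiled B H c' U', U \subset U', L \subset U' & c' <= c + #|L|].
  move=> hM; apply: greedy_cover => U u hU uL uU.
  have nV1 : n1 <= #|V| by apply: leq_trans nV; apply: leq_addr.
  by move: (hM U u hU uL); rewrite -expnS => h; exact: (hcov V nV1 H U u uH uU h).
have cLA : #|L1 :\: A| <= 2 * (r * m) by apply: leq_trans cL1; apply/subset_leq_card/subsetDl.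
have [||c1 [U1 [tU1 U01 LU1 hc1]]] := covL (L1 :\: A) (4 * (r * m) * s) _ _ _ tU0.
- move=> U u hU; rewrite !inE => /andP[uA _].
  apply: (arith_cover1_density r2 rs sm P0 hn hU hmiss).
  by rewrite leqNgt.
- by rewrite leq_mul2r; apply/orP; right; move: hc0 cLA; clear; lia.
have cLL : #|L2 :\: L1| <= 4 * (r * r * P * m).
  by apply: leq_trans cL2; apply/subset_leq_card/subsetDl.
have {}hc1 : c1 <= 4 * (r * m) by move: hc1 hc0 cLA; clear; lia.
have [||c2 [U2 [tU2 U12 LU2 hc2]]] := covL (L2 :\: L1) ((4 * (r * m) + 4 * (r * r * P * m)) * s) _ _ _ tU1.
- move=> U u hU; rewrite !inE => /andP[uA _].
  apply: (arith_cover2_density r2 rs sm P0 hn hU hmiss).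
  by rewrite leqNgt.
- by rewrite leq_mul2r; apply/orP; right; move: hc1 cLL; clear; lia.
have {}hc2 : c2 <= 4 * (r * m) + 4 * (r * r * P * m) by move: hc1 hc2 cLL; clear; lia.
have [hq hcm] := arith_rest r2 rs sm P0 hn hc2.
have cU2 := tiled_card tU2; rewrite -/s in cU2.
have cR : #|~: U2| = n - c2 * s by have := cardsC U2; rewrite cU2 -/n; clear; lia.
(* [Z] is discarded: [n = m + s * t] leaves exactly [m - s] vertices beyond [t + 1] copies, enough
   to include what remains of [A]. *)
have [||Z [AZ ZR cZ]] := @set_between _ (A :\: U2) (~: U2) (m - s).
- by rewrite setDE subsetIr.
- apply/andP; split; last by rewrite cR; move: hcm; clear; lia.
  apply: leq_trans AU0; apply/subset_leq_card/setDS; exact: subset_trans U01 U12.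
pose W := ~: U2 :\: Z.
have c2t : c2 <= t.
  by rewrite -(leq_pmul2r s0); move: hcm; rewrite nE [t * s]mulnC; clear; lia.
have cW : #|W| = (t + 1 - c2) * s.
  rewrite /W cardsD (setIidPr ZR) cZ cR nE mulnBl mulnDl mul1n [s * t]mulnC.
  have : c2 * s <= t * s by rewrite leq_mul2r c2t orbT.
  by move: sm; clear; lia.
have tW : tiled B H (t + 1 - c2) W.
  apply: (@perfect_tiling _ _ _ _ k _ (r * m * n ^ k) (n ^ k %/ (4 * (r * P)))) => //; last first.
    move=> v; rewrite !inE => /andP[vZ vU].
    have vA : v \notin A.
      by apply: contra vZ => vA; apply: (subsetP AZ); rewrite inE vA vU.
    have vL1 : v \notin L1.
      apply: contra vU => vL1; apply: (subsetP U12); apply: (subsetP LU1); rewrite !in_setD vL1 andbT.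
      exact: vA.
    have vL2 : v \notin L2.
      apply: contra vU => vL2; apply: (subsetP LU2); rewrite !in_setD vL2 andbT; exact: vL1.
    by rewrite leq_divRL ?muln_gt0 ?P0 // mulnC; rewrite inE -leqNgt in vL2.
  rewrite -/s -cW; apply: (arith_perfect r2 rs sm P0 hn _ BP) => //.
  - exact: max_card.
  - have -> : n - #|W| = c2 * s + m - s.
      have := cardsD (~: U2) Z; rewrite (setIidPr ZR) cZ cR -/W.
      by move: hcm sm; clear; lia.
    have : r * (c2 * s + m - s) <= r * (c2 * s + m) by rewrite leq_mul2l leq_subr orbT.
    by move: hq; clear; lia.
  - by apply: leq_trans nV; apply: leq_addl.
  - by rewrite mulnC leq_trunc_div.
have := tiledU tU2 tW; rewrite subnKC; last by rewrite addn1 ltnW.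
move=> h; apply: tiled_contains (h _).
by rewrite disjoint_sym disjoints_subset subsetDl.
Qed.

(** * Partite structure, the real bounds on [t], and the theorem *)

Lemma rpartite_card (T : finType) r (s : 'I_r -> nat) (part : T -> 'I_r) (B : {set {set T}}) :
  rpartite s part B ->
  [/\ #|T| = \sum_(i < r) s i, forall e, e \in B -> #|e| = r & #|B| <= \prod_(i < r) s i].
Proof.
have sum1 (e : {set T}) : #|e| = \sum_(i < r) #|[set x in e | part x == i]|.
  rewrite -sum1_card (partition_big part predT) //=.
  by apply: eq_bigr => i _; rewrite -sum1dep_card.
move=> [hs hB]; split.
- rewrite -cardsT sum1; apply: eq_bigr => i _; rewrite -hs; apply: eq_card => x.
  by rewrite !inE.
- by move=> e eB; rewrite sum1 (eq_bigr (fun _ => 1)) ?sum1_card ?card_ord // => i _; apply: hB.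
have ex e i : e \in B -> exists x, (x \in e) && (part x == i).
  move=> eB; have /eqP/cards1P[x E] := hB e eB i.
  by exists x; have := set11 x; rewrite -E inE.
have [->|/set0Pn[e0 e0B]] := eqVneq B set0; first by rewrite cards0.
pose g0 i := xchoose (ex e0 i e0B).
(* An edge is determined by its vertex in each part, so the edges inject into the product of the
   parts. *)
pose g (e : {set T}) := [ffun i => odflt (g0 i) [pick x in e | part x == i]].
have gP e i : e \in B -> (g e i \in e) /\ part (g e i) = i.
  move=> eB; rewrite ffunE; case: pickP => [x /andP[? /eqP ?]//|n]; have [x] := ex e i eB.
  by rewrite n.
have gi : {in B &, injective g}.
  suff sub e e' : e \in B -> e' \in B -> g e = g e' -> e \subset e'.
    by move=> e e' eB e'B E; apply/eqP; rewrite eqEsubset !sub.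
  move=> eB e'B E; apply/subsetP => x xe.
  have /eqP/cards1P[y yE] := hB e eB (part x).
  have [h1 h2] := gP e (part x) eB; have [h3 _] := gP e' (part x) e'B.
  have : x \in [set y] by rewrite -yE inE xe eqxx.
  have : g e (part x) \in [set y] by rewrite -yE inE h1 h2 eqxx.
  by rewrite !inE => /eqP <- /eqP ->; rewrite E.
rewrite -(card_in_imset gi).
have -> : \prod_(i < r) s i = #|family (fun i => [set x | part x == i])|.
  rewrite card_family foldrE big_map big_enum; apply: eq_bigr => i _; exact/esym/hs.
apply/subset_leq_card/subsetP => f /imsetP[e eB ->]; apply/familyP => i; rewrite inE.
by have [_ ->] := gP e i eB.
Qed.

Local Delimit Scope R_scope with coqR.

Lemma INR_muln a b : INR (a * b) = Rmult (INR a) (INR b).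
Proof. exact: mult_INR. Qed.

Lemma INR_leq a b : Rle (INR a) (INR b) -> a <= b.
Proof. by move=> /INR_le /leP. Qed.

Lemma INR_pos a : 0 < a -> Rlt 0 (INR a).
Proof. by move=> /ltP /lt_0_INR. Qed.

(** Clearing denominators in the lower bound on [t] gives [16 * e^2 * r^4 * s * P * (n - s * t) <=
    n] with [e] Euler's number, and [e^2 >= 4] lets 64 replace [16 * e^2]. *)
Lemma real_bounds (n t r s P : nat) : 0 < r -> 0 < s -> 0 < P ->
  Rle (Rminus (Rdiv (INR n) (INR s))
         (Rdiv (INR n) (Rmult (Rmult (Rmult (Rmult (INR 16) (pow (exp (INR 1)) 2)) (pow (INR r) 4))
                                (pow (INR s) 2)) (INR P))))
      (INR t) ->
  Rle (INR t) (Rdiv (INR n) (INR s)) ->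
  s * t <= n /\ 64 * (r ^ 4 * s * P * (n - s * t)) <= n.
Proof.
move=> /INR_pos r0 /INR_pos s0 /INR_pos P0 h1 h2.
have st : s * t <= n.
  apply: INR_leq; rewrite INR_muln.
  apply: (Rle_trans _ (Rmult (INR s) (Rdiv (INR n) (INR s)))); first by apply: Rmult_le_compat_l => //; lra.
  by apply: Req_le; field; lra.
split=> //; apply: INR_leq.
have e4 : Rle 4 (pow (exp (INR 1)) 2).
  have /exp_ineq1 : INR 1 <> 0%coqR by rewrite /=; lra.
  move: (exp (INR 1)) => E; rewrite /= => hE; nra.
move: (pow (exp (INR 1)) 2) h1 e4 => E h1 e4.
have -> : INR (64 * (r ^ 4 * s * P * (n - s * t))) =
   (64 * (INR r ^ 4 * INR s * INR P * (INR n - INR s * INR t)))%coqR.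
  rewrite !INR_muln minus_INR; last exact/leP.
  rewrite INR_muln; congr Rmult; first by rewrite INR_IZR_INZ.
  by rewrite /= Rmult_1_r.
set R4 := (INR r ^ 4)%coqR in h1 *.
have R40 : Rlt 0 R4 by apply: pow_lt.
have c16 : INR 16 = 16%coqR by rewrite INR_IZR_INZ.
rewrite c16 in h1.
have h3 : (16 * E * R4 * INR s * INR P * (INR n - INR s * INR t) <= INR n)%coqR.
  have Q0 : (0 <= 16 * E * R4 * INR s ^ 2 * INR P)%coqR.
    by repeat apply: Rmult_le_pos; lra.
  have := Rmult_le_compat_l _ _ _ Q0 h1.
  rewrite Rmult_minus_distr_l.
  have -> : (16 * E * R4 * INR s ^ 2 * INR P * (INR n / INR s) = 16 * E * R4 * INR s * INR P * INR n)%coqR.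
    by field; lra.
  have -> : (16 * E * R4 * INR s ^ 2 * INR P * (INR n / (16 * E * R4 * INR s ^ 2 * INR P)) = INR n)%coqR.
    by field; repeat split; lra.
  have -> : (16 * E * R4 * INR s ^ 2 * INR P * INR t = 16 * E * R4 * INR s * INR P * (INR s * INR t))%coqR.
    by ring.
  lra.
apply: Rle_trans h3.
have D0 : (0 <= R4 * INR s * INR P * (INR n - INR s * INR t))%coqR.
  apply: Rmult_le_pos; first by repeat apply: Rmult_le_pos; lra.
  by move/leP/le_INR: st; rewrite INR_muln; lra.
have -> : (16 * E * R4 * INR s * INR P * (INR n - INR s * INR t) =
  (16 * E) * (R4 * INR s * INR P * (INR n - INR s * INR t)))%coqR by ring.
by apply: Rmult_le_compat_r => //; lra.
Qed.

Lemma contains_copies_set0 (T V : finType) K : K * #|T| <= #|V| ->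
  contains (copies K (set0 : {set {set T}})) (set0 : {set {set V}}).
Proof.
move=> h; have h' : #|{: 'I_K * T}| <= #|V| by rewrite card_prod card_ord.
apply/existsP; exists [ffun z => enum_val (widen_ord h' (enum_rank z))]; apply/andP; split.
  apply/injectiveP => z z'; rewrite !ffunE => /enum_val_inj/(congr1 val)/= /val_inj.
  exact: enum_rank_inj.
by apply/forall_inP => e /bigcupP[i _ /imsetP[e']]; rewrite inE.
Qed.

Theorem theorem1p15 (r : nat) (s : 'I_r -> nat) (T : finType) (part : T -> 'I_r)
    (B : {set {set T}}) :
  (2 <= r)%N ->
  (forall i, 1 <= s i)%N ->
  (forall i j : 'I_r, (i <= j)%N -> (s i <= s j)%N) ->
  rpartite s part B ->
  let stot := (\sum_(i < r) s i)%N in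
  exists n0 : nat, forall n : nat, (n0 <= n)%N ->
  forall t : nat,
    Rle (Rminus (Rdiv (INR n) (INR stot))
               (Rdiv (INR n)
                  (Rmult (Rmult (Rmult (Rmult (INR 16) (pow (exp (INR 1)) 2)) (pow (INR r) 4))
                                (pow (INR stot) 2))
                         (INR (\prod_(i < r) s i)))))
        (INR t) ->
    Rle (INR t) (Rdiv (INR n) (INR stot)) ->
    (ex r n (copies (t + 1) B)
       <= 'C(stot * (t + 1) - 1, r) + ex_star r (n - stot * t) n (copies stot B))%N.
Proof.
case: r s part => [//|[//|k]] s part _ s_gt0 _ hB stot.
have [cT Br BP] := rpartite_card hB; have [hs partB] := hB.
set P := \prod_(i < k.+2) s i in BP *.
have P0 : 0 < P by apply: prodn_gt0.
have [x0 /eqP x0P] : exists x0, part x0 == ord0.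
  have : 0 < #|[set x | part x == ord0]| by rewrite hs.
  by move=> /card_gt0P[x]; rewrite inE; exists x.
have T0 : 0 < #|T| by apply/card_gt0P; exists x0.
have sP : #|T| <= k.+2 * P.
  rewrite cT; apply: (@leq_trans (\sum_(i < k.+2) P)); last by rewrite sum_nat_const card_ord.
  by apply: leq_sum => i _; rewrite /P (bigD1 i) //= leq_pmulr // prodn_gt0.
(* The guard [B != set0] lets one threshold, fixed before [n] and [t], serve the edgeless case
   too. *)
have [n0 hn0] : exists n0, B != set0 -> forall n (H : {set {set 'I_n}}) t X, n0 <= n ->
    uniform k.+2 H -> #|T| * (t + 1) <= n ->
    64 * (k.+2 ^ 4 * #|T| * P * (n - #|T| * t)) <= n ->
    (forall G (V1 : {set 'I_n}), uniform k.+2 G -> #|V1| = n - #|T| * t ->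
      (forall e, e \in G -> ~~ [disjoint e & V1]) -> X < #|G| -> contains (copies #|T| B) G) ->
    'C(#|T| * (t + 1) - 1, k.+2) + X < #|H| -> contains (copies (t + 1) B) H.
  have [->|B0] := eqVneq B set0; first by exists 0.
  have [n0 hn0] := @tiling_exists T B k.+1 part x0 P isT partB x0P Br B0 P0 BP sP.
  exists n0 => _ n H t X nn uH; rewrite mulnDr muln1 => tn hm hX hH.
  apply: (hn0 _ H (n - #|T| * t) t X) => //; rewrite ?card_ord //; try lia.
  by rewrite subKn; [|lia].
exists n0 => n nn t h1 h2.
have [st hm] := real_bounds (isT : 0 < k.+2) (ltac:(by rewrite /stot -cT) : 0 < stot) P0 h1 h2.
rewrite /stot -cT in st hm *.
apply/bigmax_leqP => H /andP[uH nC].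
have cH : #|H| <= 'C(n, k.+2).
  have := card_edges_disjoint (set0 : {set 'I_n}) uH; rewrite cards0 subn0 card_ord.
  rewrite (_ : [set e in H | _] = set0) ?cards0 //; apply/setP => e; rewrite !inE.
  by rewrite disjoint_sym disjoints_subset sub0set andbF.
(* When [n <= #|T| * (t + 1) - 1], the binomial coefficient alone bounds the number of all possible
   edges. *)
have [nlt|nge] := ltnP n (#|T| * (t + 1)).
  by apply: leq_trans cH _; apply: leq_trans (leq_addr _ _); apply: leq_bin2l; lia.
(* An edgeless [B] has [t + 1] disjoint copies in any graph on at least [#|T| * (t + 1)]
   vertices. *)
have [B0|B0] := eqVneq B set0.
  exfalso; move/negP: nC; apply; rewrite B0.
  have := @contains_copies_set0 T 'I_n (t + 1); rewrite card_ord mulnC => /(_ nge) /existsP[f /andP[fi /forall_inP h]].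
  by apply/existsP; exists f; rewrite fi; apply/forall_inP => e /h; rewrite inE.
rewrite leqNgt; apply: contra nC => hH; apply: (hn0 B0 n H t) nn uH nge hm _ hH => G V1.
exact: ex_star_contains.
Qed.
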